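(* Let $n\ge 1$ and let $\sigma=(2,\dots,2,1,\dots,1)\in\Omega^0_{n,n+1}$ be of type $(t,d)$ with $d>0$. Then $$\det M^{(n,n+1)}_{d+1,t+1}=\begin{vmatrix} r_{d+1,t+1}&\dots&r_{d+1,n+1}&x_{d+1,n}&\dots&x_{d+1,n+1-t}\\ \vdots&&\vdots&\vdots&&\vdots\\ r_{n+1,t+1}&\dots&r_{n+1,n+1}&x_{n+1,n}&\dots&x_{n+1,n+1-t}\\ x_{t+1,n}&\dots&x_{n+1,n}&0&\dots&0\\ \vdots&&\vdots&\vdots&&\vdots\\ x_{t+1,n+1-d}&\dots&x_{n+1,n+1-d}&0&\dots&0\end{vmatrix},$$ viewed as an element of $\mathcal{I}\otimes\mathcal{H}$, is a highest weight vector in $\operatorname{Ker}\phi_\sigma^{(n,n+1)}$ of weight $\lambda'_{(n+1)}(\sigma)$.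
   Context: General setting (with $k$ variables; the claim uses $k=n+1$). $M_{k\times n}$ is the space of complex $k\times n$ matrices with coordinates $x_{ij}$, $\mathcal{P}=\mathbb{C}[x_{11},\dots,x_{kn}]$. $O(n)=O(n,\mathbb{C})$ preserves the form $(u,v)=\sum_{l=1}^n u_lv_{n+1-l}$ and acts on $\mathcal{P}$ by $(g\cdot P)(x)=P(xg)$. $\mathcal{I}$ is the ring of $O(n)$-invariants in $\mathcal{P}$, generated by $r_{ij}=r_{ji}=\sum_l x_{il}x_{j,n+1-l}$; $\mathcal{H}$ is the common kernel in $\mathcal{P}$ of all $\Delta_{ij}=\sum_l\partial_{x_{il}}\partial_{x_{j,n+1-l}}$. Let $\mathfrak{k}=\operatorname{span}\{h_{ij}:1\le i,j\le k\}\cong\mathfrak{gl}(k)$, $h_{ij}=\sum_l x_{il}\partial_{x_{jl}}+\frac n2\delta_{ij}$, and let $\varepsilon_1,\dots,\varepsilon_k$ be the basis of $\mathfrak{h}^*$, $\mathfrak{h}=\operatorname{span}\{h_{11},\dots,h_{kk}\}$, dual to $-h_{11},\dots,-h_{kk}$. Weights are identified with their coordinates $(\lambda_1,\dots,\lambda_k)$. The Lie algebra $\mathfrak{g}$ spanned by all $r_{ij},h_{ij},\Delta_{ij}$ is isomorphic to $\mathfrak{sp}(2k,\mathbb{C})$, with roots $\Delta=\{\pm\varepsilon_i\pm\varepsilon_j\ (i<j),\ \pm2\varepsilon_i\}$, simple roots $\varepsilon_i-\varepsilon_{i+1}$ ($i<k$) and $2\varepsilon_k$, positive roots $\Delta^+$,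 non-compact positive roots $\Delta_n^+=\{\varepsilon_i+\varepsilon_j:1\le i\le j\le k\}$, and half-sum of positive roots $\rho=(k,k-1,\dots,1)$. The vector $h_{ji}$ is a root vector for $\varepsilon_i-\varepsilon_j$, $i\ne j$. Labels. $\Sigma_{n,k}$ is the set of Young diagrams with at most $n$ boxes in the first two columns together and depth (number of nonzero rows) at most $k$. $\Omega_{n,k}\subset\Sigma_{n,k}$ consists of the diagrams with at most two columns; such $\sigma=(2,\dots,2,1,\dots,1)$ is of type $(t,d)$ if it has $t$ entries equal to $2$ and depth $d$ (so $t\le d\le k$, $t+d\le n$). For $\sigma\in\Sigma_{n,k}$, $\sigma^\sharp=(-\sigma_k-\frac n2,\dots,-\sigma_1-\frac n2)$. For $\lambda=\sigma^\sharp$ let $\Psi_\lambda=\{\alpha\in\Delta:(\alpha,\lambda+\rho)=0\}$ and let $\Gamma^k_\lambda$ be the set of $\alpha\in\Delta_n^+$ such that (i) $(\lambda+\rho,\alpha^\vee)\in\{1,2,3,\dots\}$, where $\alpha^\vee$ is the coroot; (ii) $\alpha$ is orthogonal to $\Psi_\lambda$; (iii) if $\Psi_\lambda$ contains a long root, then $\alpha$ is short (long roots are $\pm2\varepsilon_i$). Let $\Sigma^0_{n,k}=\{\sigma\in\Sigma_{n,k}:\Gamma^k_{\sigma^\sharp}\neq\emptyset\}$ and $\Omega^0_{n,k}=\Omega_{n,k}\cap\Sigma^0_{n,k}$. For $\sigma\in\Sigma^0_{n,k}$, the set $\Gamma^k_{\sigma^\sharp}$ has a unique minimum $\gamma$ in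 the usual partial order on roots ($\alpha\le\beta$ iff $\beta-\alpha$ is a sum of positive roots), and $\lambda'_{(k)}(\sigma)=(s_\gamma(\sigma^\sharp+\rho))^+-\rho$, where $s_\gamma$ is the root reflection and $\mu^+$ denotes the weakly decreasing rearrangement of the coordinates of $\mu$. Kernel. For $1\le j\le m=\min(n,k)$, $\delta_j$ is the determinant of the bottom right $j\times j$ submatrix of $x=(x_{il})_{k\times n}$, and $\delta_\sigma=\prod_{j=1}^m\delta_j^{\sigma_j-\sigma_{j+1}}$ ($\sigma_{m+1}:=0$). $F_{\sigma^\sharp}\subset\mathcal{H}$ is the irreducible $\mathfrak{k}$-module generated by $\delta_\sigma$; it has highest weight $\sigma^\sharp$. $\phi_\sigma^{(n,k)}:\mathcal{I}\otimes F_{\sigma^\sharp}\to\mathcal{P}$ is $I\otimes H\mapsto IH$. $\mathfrak{k}$ acts on $\mathcal{I}\otimes F_{\sigma^\sharp}$ by $h_{ij}\cdot(I\otimes H)=\big(\sum_l x_{il}\partial_{x_{jl}}I\big)\otimes H+I\otimes h_{ij}H$. A highest weight vector of weight $\mu$ is a nonzero $v$ with $h_{ii}v=-\mu_iv$ for all $i$ and $h_{ji}v=0$ for all $i<j$. Matrices. $J_n$ is the $n\times n$ matrix with ones on the antidiagonal and zeros elsewhere, and $M^{(n,k)}=\begin{pmatrix}x\\ I_n\end{pmatrix}J_n\,(x^T,\,I_n)$, a symmetric $(n+k)\times(n+k)$ matrix whose upper left $k\times k$ block is $(r_{ij})$ and whose remaining entries are $x_{ij}$'s, $0$'s and $1$'s.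 $M^{(n,k)}_{a,b}$ is the square submatrix of order $n+1$ whose $(i,j)$ entry is the $(a+i-1,b+j-1)$ entry of $M^{(n,k)}$. Its determinant is viewed as an element of $\mathcal{I}\otimes\mathcal{H}$ by formally expanding it and placing the sign $\otimes$ between the product of the $r_{ij}$ entries (in $\mathcal{I}$) and the product of the $x_{ij}$ entries. *)

(* Defs.v *)
From HB Require Import structures.
From mathcomp Require Import all_boot all_order all_algebra.
From mathcomp Require Import mpoly complex.
From mathcomp Require Import boolp classical_sets reals.

Set Implicit Arguments.
Unset Strict Implicit.
Unset Printing Implicit Defensive.

Import Order.TTheory GRing.Theory Num.Theory.

Local Open Scope ring_scope.

(* Indices are 0-based throughout: the paper's l in {1..n} is l - 1 here, and
   its n + 1 - l becomes [rev_ord l].  The only exception is [submx_at],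
   whose corner (a, b) is 1-based. *)

(* The polynomial ring of M_{k x n}; the entry (i, l) of the generic matrix is
   the variable of index [mxvec_index i l]. *)
Notation polyM C k n := {mpoly C[(k * n)%N]}.

(* P (x)_C P, with P = polyM C k n, is realised as the polynomial ring over P
   in a second copy of the variables: the left tensor factor sits in the
   coefficients and the right one in the new variables (see [tens]). *)
Notation polyMM C k n := {mpoly {mpoly C[(k * n)%N]}[(k * n)%N]}.

(* Matrix entries indexed by natural numbers.  The junk value 0 outside the
   matrix is never reached in the uses below. *)
Definition mxat (S : nmodType) (p q : nat) (A : 'M[S]_(p, q)) (i j : nat) : S :=
  match insub i, insub j with
  | Some i', Some j' => A i' j'
  | _, _ => 0
  end.

Definition submx_at (S : nmodType) (p q m : nat) (A : 'M[S]_(p, q))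
    (a b : nat) : 'M[S]_m :=
  \matrix_(i < m, j < m) mxat A (a.-1 + i) (b.-1 + j).

Definition gen_mx (C : fieldType) (k n : nat) : 'M[polyM C k n]_(k, n) :=
  \matrix_(i, l) 'X_(mxvec_index i l).

Definition rform (C : fieldType) (k n : nat) (i j : 'I_k) : polyM C k n :=
  \sum_(l < n) gen_mx C k n i l * gen_mx C k n j (rev_ord l).

Definition dx (C : fieldType) (k n : nat) (i : 'I_k) (l : 'I_n)
    (p : polyM C k n) : polyM C k n :=
  p^`M(mxvec_index i l).

Definition laplacian (C : fieldType) (k n : nat) (i j : 'I_k)
    (p : polyM C k n) : polyM C k n :=
  \sum_(l < n) dx i l (dx j (rev_ord l) p).

Definition harmonic (C : fieldType) (k n : nat) (p : polyM C k n) : Prop :=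
  forall i j : 'I_k, laplacian i j p = 0.

Definition bform (C : fieldType) (n : nat) (u v : 'rV[C]_n) : C :=
  \sum_(l < n) u 0 l * v 0 (rev_ord l).

Definition orthogonal_mx (C : fieldType) (n : nat) (g : 'M[C]_n) : Prop :=
  forall u v : 'rV[C]_n, bform (u *m g) (v *m g) = bform u v.

(* (g . P)(x) = P(x g): the variable at position [v] of the vectorised matrix
   is replaced by the same entry of x g. *)
Definition orth_act (C : fieldType) (k n : nat) (g : 'M[C]_n)
    (p : polyM C k n) : polyM C k n :=
  mmap (@mpolyC (k * n) C)
    (fun v => mxvec (gen_mx C k n *m map_mx (@mpolyC (k * n) C) g) 0 v) p.

Definition O_invariant (C : fieldType) (k n : nat) (p : polyM C k n) :
    Prop :=
  forall g : 'M[C]_n, orthogonal_mx g -> orth_act g p = p.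

(* h_ij without its constant term: this is how h_ij acts on invariants. *)
Definition polar (C : fieldType) (k n : nat) (i j : 'I_k)
    (p : polyM C k n) : polyM C k n :=
  \sum_(l < n) gen_mx C k n i l * dx j l p.

Definition hop (C : fieldType) (k n : nat) (i j : 'I_k)
    (p : polyM C k n) : polyM C k n :=
  polar i j p + (n%:R / 2%:R *+ (i == j)) *: p.

Definition tensl (C : fieldType) (k n : nat) (p : polyM C k n) :
    polyMM C k n :=
  p%:MP.

Definition tensr (C : fieldType) (k n : nat) (p : polyM C k n) :
    polyMM C k n :=
  map_mpoly (@mpolyC (k * n) C) p.

Definition tens (C : fieldType) (k n : nat) (p q : polyM C k n) :
    polyMM C k n :=
  tensl p * tensr q.

(* Membership in A (x) B for linear subspaces A, B of P. *)
Definition in_tensor (C : fieldType) (k n : nat) (A B : polyM C k n -> Prop)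
    (z : polyMM C k n) : Prop :=
  exists s : seq (polyM C k n * polyM C k n),
    (forall pq, pq \in s -> A pq.1 /\ B pq.2) /\
    z = \sum_(pq <- s) tens pq.1 pq.2.

(* The multiplication p (x) q |-> p q; see [mult_map_tens]. *)
Definition mult_map (C : fieldType) (k n : nat) (z : polyMM C k n) :
    polyM C k n :=
  z.@[fun v => 'X_v].

(* h_ij . (p (x) q) = polar_ij p (x) q + p (x) h_ij q; see [tens_act_tens]. *)
Definition tens_act (C : fieldType) (k n : nat) (i j : 'I_k)
    (z : polyMM C k n) : polyMM C k n :=
  map_mpoly (@polar C k n i j) z
  + (\sum_(l < n) 'X_(mxvec_index i l) * z^`M(mxvec_index j l)
     + ((n%:R / 2%:R *+ (i == j))%:MP : polyM C k n) *: z).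

Definition is_hwv (C : fieldType) (k n : nat) (mu : 'rV[rat]_k)
    (z : polyMM C k n) : Prop :=
  [/\ z != 0,
      forall i : 'I_k,
        tens_act i i z = ((- ratr (mu 0 i))%:MP : polyM C k n) *: z
    & forall i j : 'I_k, (i < j)%N -> tens_act j i z = 0].

Definition is_diagram (s : seq nat) : bool := sorted geq s && (0%N \notin s).

(* Length of the j-th column, j >= 0. *)
Definition col_len (s : seq nat) (j : nat) : nat := count (fun r => j < r)%N s.

Definition in_Sigma (n k : nat) (s : seq nat) : bool :=
  [&& is_diagram s, (size s <= k)%N & (col_len s 0 + col_len s 1 <= n)%N].

Definition in_Omega (n k : nat) (s : seq nat) : bool :=
  in_Sigma n k s && all (fun r => r <= 2)%N s.

Definition has_type (t d : nat) (s : seq nat) : bool :=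
  (s == nseq t 2%N ++ nseq (d - t) 1%N) && (t <= d)%N.

(* All weights involved have half-integral coordinates. *)
Definition sharp (n k : nat) (s : seq nat) : 'rV[rat]_k :=
  \row_(i < k) (- (nth 0%N s (rev_ord i))%:R - n%:R / 2%:R).

Definition rho (k : nat) : 'rV[rat]_k := \row_(i < k) (k - i)%N%:R.

Definition eps (k : nat) (i : 'I_k) : 'rV[rat]_k := delta_mx 0 i.

Definition dot (k : nat) (u v : 'rV[rat]_k) : rat :=
  \sum_(i < k) u 0 i * v 0 i.

Definition coroot (k : nat) (a : 'rV[rat]_k) : 'rV[rat]_k :=
  (2%:R / dot a a) *: a.

Definition reflect_root (k : nat) (a v : 'rV[rat]_k) : 'rV[rat]_k :=
  v - dot v (coroot a) *: a.

Definition is_long (k : nat) (a : 'rV[rat]_k) : Prop :=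
  exists (i : 'I_k) (b : bool), a = (-1) ^+ b *: (eps i *+ 2).

Definition is_short (k : nat) (a : 'rV[rat]_k) : Prop :=
  exists (i j : 'I_k) (b c : bool),
    (i < j)%N /\ a = (-1) ^+ b *: eps i + (-1) ^+ c *: eps j.

Definition is_root (k : nat) (a : 'rV[rat]_k) : Prop :=
  is_short a \/ is_long a.

Definition pos_root (k : nat) (a : 'rV[rat]_k) : Prop :=
  (exists (i j : 'I_k) (c : bool),
     (i < j)%N /\ a = eps i + (-1) ^+ c *: eps j) \/
  (exists i : 'I_k, a = eps i *+ 2).

Definition noncompact_pos_root (k : nat) (a : 'rV[rat]_k) : Prop :=
  exists i j : 'I_k, (i <= j)%N /\ a = eps i + eps j.

Definition root_le (k : nat) (a b : 'rV[rat]_k) : Prop :=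
  exists s : seq 'rV[rat]_k,
    (forall c, c \in s -> pos_root c) /\ b - a = \sum_(c <- s) c.

Definition in_Psi (k : nat) (lam a : 'rV[rat]_k) : Prop :=
  is_root a /\ dot a (lam + rho k) = 0.

Definition in_Gamma (k : nat) (lam a : 'rV[rat]_k) : Prop :=
  [/\ noncompact_pos_root a,
      exists m : nat, (0 < m)%N /\ dot (lam + rho k) (coroot a) = m%:R,
      forall b, in_Psi lam b -> dot a b = 0
    & (exists b, in_Psi lam b /\ is_long b) -> is_short a].

Definition in_Sigma0 (n k : nat) (s : seq nat) : Prop :=
  in_Sigma n k s /\ exists a, in_Gamma (sharp n k s) a.

Definition in_Omega0 (n k : nat) (s : seq nat) : Prop :=
  in_Omega n k s /\ in_Sigma0 n k s.

Definition is_min_Gamma (k : nat) (lam g : 'rV[rat]_k) : Prop :=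
  in_Gamma lam g /\ forall a, in_Gamma lam a -> root_le g a.

(* The minimum of Gamma, which is unique by [is_min_Gamma_inj] (and 0 if
   there is no minimum). *)
Definition min_Gamma (k : nat) (lam : 'rV[rat]_k) : 'rV[rat]_k :=
  xget 0 [set g | is_min_Gamma lam g].

Definition decr_rearr (k : nat) (mu : 'rV[rat]_k) : 'rV[rat]_k :=
  \row_(i < k) nth 0 (sort (fun a b : rat => b <= a)
                           [seq mu 0 j | j <- enum 'I_k]) i.

Definition lambda' (n k : nat) (s : seq nat) : 'rV[rat]_k :=
  decr_rearr
    (reflect_root (min_Gamma (sharp n k s)) (sharp n k s + rho k)) - rho k.

Definition delta (C : fieldType) (k n j : nat) : polyM C k n :=
  \det (submx_at j (gen_mx C k n) (k - j).+1 (n - j).+1).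

(* The paper's convention sigma_{m+1} = 0 is automatic for diagrams in
   Sigma_{n,k}, whose depth is at most min(n, k). *)
Definition delta_diagram (C : fieldType) (k n : nat) (s : seq nat) :
    polyM C k n :=
  \prod_(1 <= j < (minn n k).+1)
    delta C k n j ^+ (nth 0%N s j.-1 - nth 0%N s j).

Definition is_submodule (C : fieldType) (k n : nat)
    (V : polyM C k n -> Prop) : Prop :=
  [/\ V 0,
      forall (c : C) (p q : polyM C k n), V p -> V q -> V (c *: p + q)
    & forall (i j : 'I_k) (p : polyM C k n), V p -> V (hop i j p)].

(* The module generated by delta_diagram s. *)
Definition in_F (C : fieldType) (k n : nat) (s : seq nat)
    (p : polyM C k n) : Prop :=
  forall V : polyM C k n -> Prop,
    is_submodule V -> V (delta_diagram C k n s) -> V p.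

Definition in_Ker_mult (C : fieldType) (k n : nat) (s : seq nat)
    (z : polyMM C k n) : Prop :=
  in_tensor (@O_invariant C k n) (@in_F C k n s) z /\ mult_map z = 0.

Definition antidiag (S : pzRingType) (n : nat) : 'M[S]_n :=
  \matrix_(i, j) (j == rev_ord i)%:R.

Definition big_mx (C : fieldType) (k n : nat) : 'M[polyM C k n]_(k + n) :=
  col_mx (gen_mx C k n) 1%:M *m antidiag (polyM C k n) n
    *m row_mx (gen_mx C k n)^T 1%:M.

(* The entries of the upper left block (the r_ij) go to the left tensor
   factor, all other entries to the right one.  The determinant over the
   commutative ring P (x) P of a submatrix is then its formal expansion, with
   the sign (x) between the products of r_ij's and of x_ij's. *)
Definition big_tens_mx (C : fieldType) (k n : nat) :
    'M[polyMM C k n]_(k + n) :=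
  let M := big_mx C k n in
  block_mx (map_mx (@tensl C k n) (ulsubmx M))
           (map_mx (@tensr C k n) (ursubmx M))
           (map_mx (@tensr C k n) (dlsubmx M))
           (map_mx (@tensr C k n) (drsubmx M)).

Definition sub_tens_mx (C : fieldType) (k n a b : nat) :
    'M[polyMM C k n]_n.+1 :=
  submx_at n.+1 (big_tens_mx C k n) a b.

(* The explicit matrix, for k = n + 1: blocks of rows of heights n + 1 - d and
   d, blocks of columns of widths n + 1 - t and t. *)
Definition explicit_mx (C : fieldType) (n d t : nat) :
    'M[polyMM C n.+1 n]_n.+1 :=
  let r i j := mxat (\matrix_(p, q) tensl (rform C n p q) : 'M_n.+1) i j in
  let x i l := mxat (map_mx (@tensr C n.+1 n) (gen_mx C n.+1 n)) i l in
  \matrix_(i < n.+1, j < n.+1)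
    if (i < n.+1 - d)%N then
      if (j < n.+1 - t)%N then r (d + i)%N (t + j)%N
      else x (d + i)%N (n.-1 - (j - (n.+1 - t)))%N
    else
      if (j < n.+1 - t)%N then x (t + j)%N (n.-1 - (i - (n.+1 - d)))%N
      else 0.

Lemma tensr_mul (C : fieldType) (k n : nat) (p q : polyM C k n) :
  tensr (p * q) = tensr p * tensr q.
Proof. exact: rmorphM. Qed.

Lemma mult_map_tens (C : fieldType) (k n : nat) (p q : polyM C k n) :
  mult_map (tens p q) = p * q.
Proof.
rewrite /mult_map /tens /tensl /tensr mevalM mevalC; congr (_ * _).
rewrite {1}(mpolyE q) [in RHS](mpolyE q).
rewrite (rmorph_sum (map_mpoly (@mpolyC (k * n) C))) /=.
rewrite (rmorph_sum (meval _)) /=; apply: eq_bigr => m _.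
rewrite map_mpolyZ map_mpolyX mevalZ mevalX.
by rewrite -mpolyXE_id mul_mpolyC.
Qed.

Lemma mcoeff_tens (C : fieldType) (k n : nat) (p q : polyM C k n) m :
  (tens p q)@_m = q@_m *: p.
Proof. by rewrite mcoeffCM mcoeff_map_mpoly mulrC mul_mpolyC. Qed.

Lemma tens_act_tens (C : fieldType) (k n : nat) (i j : 'I_k)
    (p q : polyM C k n) :
  tens_act i j (tens p q) = tens (polar i j p) q + tens p (hop i j q).
Proof.
rewrite /tens_act; congr (_ + _).
  have polarD : zmod_morphism (@polar C k n i j).
    move=> u v; rewrite /polar -sumrB; apply: eq_bigr => l _.
    by rewrite /dx mderivB mulrBr.
  pose A := GRing.isZmodMorphism.Build _ _ _ polarD.
  pose f : {additive polyM C k n -> polyM C k n} :=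
    HB.pack (@polar C k n i j) A.
  apply/mpolyP => m.
  rewrite (mcoeff_map_mpoly f) !mcoeff_tens /= /polar scaler_sumr.
  by apply: eq_bigr => l _; rewrite /dx mderivZ scalerAr.
have dtens (v : 'I_(k * n)) : (tens p q)^`M(v) = tens p q^`M(v).
  rewrite /tens /tensl mderivM mderivC mul0r add0r; congr (_ * _).
  apply/mpolyP => m.
  by rewrite mcoeff_deriv !mcoeff_map_mpoly /= mcoeff_deriv mpolyCMn.
rewrite /hop /tens /tensr (rmorphD (map_mpoly _)) /= mulrDr; congr (_ + _); last first.
  by rewrite map_mpolyZ scalerAr.
rewrite /polar (rmorph_sum (map_mpoly _)) /= [RHS]mulr_sumr; apply: eq_bigr => l _.
rewrite dtens /tens /tensr rmorphM /= mxE map_mpolyX.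
by rewrite mulrCA.
Qed.

Lemma is_min_Gamma_inj (k : nat) (lam g h : 'rV[rat]_k) :
  is_min_Gamma lam g -> is_min_Gamma lam h -> g = h.
Proof.
move=> [Gg ming] [Gh minh].
have [s [sP ds]] := ming _ Gh; have [s' [sP' ds']] := minh _ Gg.
have dotD u v : dot (u + v) (rho k) = dot u (rho k) + dot v (rho k).
  by rewrite /dot -big_split; apply: eq_bigr => i _; rewrite mxE mulrDl.
have dot0 : dot 0 (rho k) = 0.
  by rewrite /dot big1 // => i _; rewrite mxE mul0r.
have dote i : dot (eps i) (rho k) = (k - i)%N%:R.
  rewrite /dot (bigD1 i) //= big1 => [|j ji]; rewrite !mxE ?eqxx ?mul1r ?addr0 //.
  by rewrite (negPf ji) andbF mul0r.
have dotN u : dot (- u) (rho k) = - dot u (rho k).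
  by rewrite /dot -sumrN; apply: eq_bigr => i _; rewrite mxE mulNr.
have pos c : pos_root c -> 0 < dot c (rho k).
  case=> [[i [j [b [ij ->]]]]|[i ->]]; last first.
    by rewrite mulr2n dotD !dote -natrD ltr0n addn_gt0 subn_gt0 ltn_ord.
  case: b; rewrite ?expr1 ?expr0 ?scaleN1r ?scale1r dotD ?dotN !dote.
    by rewrite subr_gt0 ltr_nat ltn_sub2l.
  by rewrite -natrD ltr0n addn_gt0 subn_gt0 ltn_ord.
have sumge (u : seq 'rV[rat]_k) : (forall c, c \in u -> pos_root c) ->
    0 <= dot (\sum_(c <- u) c) (rho k) /\
    (dot (\sum_(c <- u) c) (rho k) = 0 -> u = [::]).
  elim: u => [|a u IH] H; first by rewrite big_nil dot0.
  have [|ge0 _] := IH; first by move=> c cu; apply: H; rewrite inE cu orbT.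
  have gt0 := pos a (H a (mem_head _ _)).
  rewrite big_cons dotD; split; first by rewrite addr_ge0 // ltW.
  by move/eqP; rewrite gt_eqF // ltr_wpDr.
have [s0 snil] := sumge _ sP; have [s0' _] := sumge _ sP'.
have E : dot (\sum_(c <- s) c) (rho k) = 0.
  apply/le_anti; rewrite s0 andbT -ds -(opprB g) dotN ds' oppr_le0 //.
by move: ds; rewrite (snil E) big_nil => /eqP; rewrite subr_eq0 => /eqP.
Qed.

(* Main.v *)
Require Import Defs.
From HB Require Import structures.
From mathcomp Require Import all_boot all_order all_algebra.
From mathcomp Require Import mpoly complex.
From mathcomp Require Import boolp classical_sets reals.
From mathcomp Require Import perm.
From mathcomp Require Import zify ring lra.
Set Implicit Arguments.
Unset Strict Implicit.
Unset Printing Implicit Defensive.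

Import Order.TTheory GRing.Theory Num.Theory.
Local Open Scope ring_scope.

(** The determinant [D] is taken over the tensor product, realised as a
    commutative ring, and it has the form of a bordered determinant: an upper
    left block of [r_ij], two borders of [x_ij] and a zero block.

    Kernel.  The multiplication map turns the matrix into a submatrix of order
    [n + 1] of a matrix that factors through rank [n]; hence its determinant
    is mapped to zero ([mult_map_det_sub_tens]).

    Membership.  Expanding [D] over its upper left block ([bordered_ind])
    writes it as a combination of products of [r_ij] tensored with products
    [minor a * minor b] of a [t]-rowed minor on the last [t] columns and a
    [d]-rowed minor on the last [d] columns.  The [r_ij] are invariants.  The
    products of minors are harmonic, because [t + d <= n] rules out mixed
    second derivatives and the others cancel by antisymmetry
    ([harmonic_minors]).  They lie in the module generated by [delta_diagram],
    which is one of them: polarisations permute the row labels, and the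
    exchange relations between minors separate the two factors
    ([submod_minors]).

    Highest weight.  Up to a scalar, [h_ij] acts as a derivation that
    substitutes row labels, both in the [r_ij] and in the [x_ij].  For
    [j <= i] this multiplies the matrix on either side by a matrix unit or
    zero, hence the determinant by the sum of the two traces
    ([tens_act_det_bordered]): zero off the diagonal, and on the diagonal the
    number of occurrences of the label [i].  The determinant is nonzero since
    it has a nonzero value at some point ([det_bordered_neq0]).

    Weight.  Up to a shift, the coordinates of [lam + rho] fill an interval
    with two gaps, and [eps i + eps j] is orthogonal to it when the values at
    [i] and [j] are mirror images in the interval.  So the only indices that
    can occur in [Gamma] are those mirrored to the gaps.  This leaves
    a single root, and its reflection moves the gaps to their mirror images
    ([lambda'_two_columns]). *)

(** * Derivations and determinants *)

Section DerivationDet.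
Variables (S : comNzRingType) (D : S -> S).
Hypothesis DD : {morph D : x y / x + y}.
Hypothesis DM : forall x y, D (x * y) = D x * y + x * D y.

Lemma der0 : D 0 = 0.
Proof. by apply: (@addrI _ (D 0)); rewrite -DD !addr0. Qed.

Lemma der1 : D 1 = 0.
Proof.
apply: (@addrI _ (D 1)).
by rewrite -{1}[D 1]mulr1 -{2}[D 1]mul1r -DM mulr1 addr0.
Qed.

Lemma derN x : D (- x) = - D x.
Proof. by apply/eqP; rewrite -addr_eq0 -DD addNr der0. Qed.

Lemma der_sum (I : Type) (r : seq I) (P : pred I) (F : I -> S) :
  D (\sum_(i <- r | P i) F i) = \sum_(i <- r | P i) D (F i).
Proof. exact: (big_morph _ DD der0). Qed.

Lemma der_sign (b : bool) x : D ((-1) ^+ b * x) = (-1) ^+ b * D x.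
Proof. by rewrite !mulr_sign; case: b; rewrite ?derN. Qed.

Lemma der_prod_seq (I : eqType) (r : seq I) (F : I -> S) : uniq r ->
  D (\prod_(i <- r) F i)
  = \sum_(i <- r) \prod_(j <- r) (if j == i then D (F j) else F j).
Proof.
elim: r => [|i r IH] /=; first by rewrite !big_nil der1.
move=> /andP [ir ur]; rewrite !big_cons eqxx DM IH //; congr (_ * _ + _).
  by rewrite !big_seq; apply: eq_bigr => j jr; case: eqP ir jr => // -> /negPf
    ->.
rewrite mulr_sumr !big_seq; apply: eq_bigr => j jr; rewrite big_cons.
by case: eqP ir jr => // -> /negPf ->.
Qed.

Lemma der_det_row m (A : 'M[S]_m) :
  D (\det A) =
  \sum_i \det (\matrix_(p, q) (if p == i then D (A p q) else A p q)).
Proof.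
rewrite /determinant der_sum exchange_big /=; apply: eq_bigr => s _.
rewrite der_sign der_prod_seq ?index_enum_uniq // mulr_sumr.
apply: eq_bigr => i _; congr (_ * _).
by apply: eq_bigr => p _; rewrite mxE.
Qed.

Lemma der_det_cofactor m (A : 'M[S]_m) :
  D (\det A) = \sum_i \sum_j D (A i j) * cofactor A i j.
Proof.
rewrite der_det_row; apply: eq_bigr => i _; rewrite (expand_det_row _ i).
apply: eq_bigr => j _; rewrite mxE eqxx; congr (_ * _).
rewrite !expand_cofactor; apply: eq_bigr => s _; congr (_ * _).
by apply: eq_bigr => p ip; rewrite mxE eq_sym (negPf ip).
Qed.

(** An infinitesimal row and column change acts on a determinant through its
    trace: by Jacobi's formula [D (\det A)] is the trace of [D A] times the
    adjugate of [A], and the adjugate cancels [A] on either side. *)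
Lemma der_det_lin m (A P Q : 'M[S]_m) :
  map_mx D A = P *m A + A *m Q -> D (\det A) = (\tr P + \tr Q) * \det A.
Proof.
move=> E; have -> : D (\det A) = \tr (map_mx D A *m \adj A).
  rewrite der_det_cofactor; apply: eq_bigr => i _; rewrite mxE.
  by apply: eq_bigr => j _; rewrite !mxE.
rewrite E mulmxDl mxtraceD -mulmxA mul_mx_adj mul_mx_scalar mxtraceZ.
by rewrite -mulmxA mxtrace_mulC -mulmxA mul_adj_mx mul_mx_scalar mxtraceZ
  -mulrDr mulrC.
Qed.

End DerivationDet.

(** * Minors on the last columns *)

Definition upd (T : Type) m (a : 'I_m -> T) s x : 'I_m -> T :=
  fun p => if p == s then x else a p.

(** Columns are counted from the right, so that minors of different sizes
    always involve an initial segment of this numbering. *)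
Definition xrev (C : fieldType) (k n : nat) (i : 'I_k) (l : nat) :
  polyM C k n :=
  mxat (gen_mx C k n) i (n.-1 - l).

(** Rows may repeat and come in any order, which makes polarisation a plain
    substitution of row labels. *)
HB.lock Definition minor (C : fieldType) (k n m : nat) (a : 'I_m -> 'I_k) :
    polyM C k n :=
  \det (\matrix_(p < m, q < m) xrev C n (a p) q).

Section Minors.
Variables (C : fieldType) (k n : nat).
Implicit Types (i j : 'I_k).
Notation xrev := (@xrev C k n).
Notation minor := (@minor C k n _).

Lemma mxat_ord (S : nmodType) p q (A : 'M[S]_(p, q)) (i : 'I_p) (j : 'I_q) :
  mxat A i j = A i j.
Proof. by rewrite /mxat !valK. Qed.

Lemma mxvec_index_eq p q (i i' : 'I_p) (j j' : 'I_q) :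
  (mxvec_index i j == mxvec_index i' j') = (i == i') && (j == j').
Proof.
by rewrite (inj_eq (@cast_ord_inj _ _ _)) (inj_eq enum_rank_inj).
Qed.

Lemma dx_gen i j (l l' : 'I_n) :
  dx i l (gen_mx C k n j l') = ((i == j) && (l == l'))%:R.
Proof.
rewrite /dx mxE mderivX mnm1E mxvec_index_eq [j == i]eq_sym [l' == l]eq_sym.
case: andP => [[/eqP-> /eqP->]|_]; last by rewrite scale0r.
by rewrite scale1r (_ : (_ - _)%MM = 0%MM) ?mpolyX0 //; apply/mnmP => v;
  rewrite mnmBE subnn mnm0E.
Qed.

Lemma dxD i (l : 'I_n) : {morph @dx C k n i l : p q / p + q}.
Proof. exact: mderivD. Qed.

Lemma dxM i (l : 'I_n) (p q : polyM C k n) :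
  dx i l (p * q) = dx i l p * q + p * dx i l q.
Proof. exact: mderivM. Qed.

Lemma polarD i j : {morph @polar C k n i j : p q / p + q}.
Proof.
by move=> p q; rewrite -big_split; apply: eq_bigr => l _; rewrite dxD mulrDr.
Qed.

Lemma polarM i j (p q : polyM C k n) :
  polar i j (p * q) = polar i j p * q + p * polar i j q.
Proof.
rewrite mulr_suml mulr_sumr -big_split; apply: eq_bigr => l _ /=.
by rewrite dxM mulrDr mulrA [in X in _ + X]mulrCA.
Qed.

Lemma polar_gen i j a (l : 'I_n) :
  polar i j (gen_mx C k n a l) = (if a == j then gen_mx C k n i l else 0).
Proof.
rewrite /polar (bigD1 l) //= big1 => [|l' /negPf l'l]; rewrite dx_gen.
  by rewrite eqxx andbT addr0 eq_sym; case: eqP; rewrite ?mulr1 ?mulr0.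
by rewrite l'l andbF mulr0.
Qed.

Lemma xrev_ord i (l : 'I_n) : xrev i l = gen_mx C k n i (rev_ord l).
Proof.
rewrite /xrev (_ : (n.-1 - l)%N = rev_ord l :> nat) ?mxat_ord //=; lia.
Qed.

Lemma polar_xrev i j a l :
  polar i j (xrev a l) = (if a == j then xrev i l else 0).
Proof.
rewrite /xrev /mxat !valK; case: (insub _) => [c|]; first exact: polar_gen.
by rewrite (der0 (polarD i j)) if_same.
Qed.

Lemma eq_minor m (a b : 'I_m -> 'I_k) : a =1 b -> minor a = minor b.
Proof.
move=> ab; rewrite unlock; congr (\det _); apply/matrixP => p q.
by rewrite !mxE ab.
Qed.

Lemma minor_perm m (a : 'I_m -> 'I_k) (s : 'S_m) :
  minor (a \o s) = (-1) ^+ s * minor a.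
Proof.
rewrite unlock -det_perm -det_mulmx -row_permE; congr (\det _).
by apply/matrixP => p q; rewrite !mxE.
Qed.

Lemma minor_tperm m (a : 'I_m -> 'I_k) p q : p != q ->
  minor (a \o tperm p q) = - minor a.
Proof. by move=> pq; rewrite minor_perm odd_tperm pq mulN1r. Qed.

Lemma minor_dup m (a : 'I_m -> 'I_k) p q : p != q -> a p = a q -> minor a = 0.
Proof.
by move=> pq apq; rewrite unlock; apply: (determinant_alternate pq) => r;
  rewrite !mxE apq.
Qed.

Lemma minor_inj m (a : 'I_m -> 'I_k) : ~ injective a -> minor a = 0.
Proof.
move=> /injectiveP /injectivePn [p [q pq apq]].
exact: minor_dup pq apq.
Qed.

(** A polarisation is a derivation that replaces the row [j] by the row [i];
    on a determinant it does so at one occurrence of [j] at a time. *)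
Lemma polar_minor i j m (a : 'I_m -> 'I_k) :
  polar i j (minor a) = \sum_(s | a s == j) minor (upd a s i).
Proof.
rewrite unlock (der_det_row (polarD i j) (polarM i j)) [RHS]big_mkcond.
apply: eq_bigr => s _; have [as_j|as_j] := eqVneq.
  congr (\det _); apply/matrixP => p q; rewrite !mxE /upd.
  by have [->|//] := eqVneq p s; rewrite polar_xrev as_j eqxx.
rewrite (expand_det_row _ s) big1 // => q _.
by rewrite !mxE eqxx polar_xrev (negPf as_j) mul0r.
Qed.

Lemma polar_minor_once i j m (a : 'I_m -> 'I_k) s :
  a s = j -> (forall p, a p = j -> p = s) ->
  polar i j (minor a) = minor (upd a s i).
Proof.
move=> as_j uniq_s; rewrite polar_minor (bigD1 s) ?as_j ?eqxx //=.
by rewrite big1 ?addr0 // => p /andP [/eqP /uniq_s -> /eqP].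
Qed.

Lemma polar_minor_notin i j m (a : 'I_m -> 'I_k) :
  j \notin codom a -> polar i j (minor a) = 0.
Proof.
move=> ja; rewrite polar_minor big1 // => p /eqP ap.
by rewrite -ap codom_f in ja.
Qed.

Lemma minor_row m (a : 'I_m -> 'I_k) s :
  minor a =
  \sum_(q < m)
    xrev (a s) q * cofactor (\matrix_(p < m, q < m) xrev (a p) q) s q.
Proof.
by rewrite unlock (expand_det_row _ s); apply: eq_bigr => q _; rewrite mxE.
Qed.

Lemma cofactor_upd m (a : 'I_m -> 'I_k) s i q :
  cofactor (\matrix_(p < m, q < m) xrev (upd a s i p) q) s q =
  cofactor (\matrix_(p < m, q < m) xrev (a p) q) s q.
Proof.
rewrite !expand_cofactor; apply: eq_bigr => u _; congr (_ * _).
apply: eq_bigr => p sp; rewrite [LHS]mxE [RHS]mxE.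
by rewrite /upd [p == s]eq_sym (negPf sp).
Qed.

Lemma minor_upd m (a : 'I_m -> 'I_k) s i :
  minor (upd a s i) =
  \sum_(q < m) xrev i q * cofactor (\matrix_(p < m, q < m) xrev (a p) q) s q.
Proof.
rewrite (minor_row _ s); apply: eq_bigr => q _.
by rewrite cofactor_upd {1}/upd [s == s]eqxx.
Qed.

(** The quadratic relations between flag minors.  By Cramer's rule the row
    [a s], cut down to the last [d] columns, is the combination of the rows
    [b m] with coefficients [minor (upd b m (a s)) / minor b]; since [t <= d]
    this also holds on the last [t] columns, and [minor a] is linear in its row
    [s]. *)
Lemma exchange_minors t d (a : 'I_t -> 'I_k) (b : 'I_d -> 'I_k) (s : 'I_t) :
  (t <= d)%N ->
  minor a * minor b =
  \sum_m minor (upd a s (b m)) * minor (upd b m (a s)).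
Proof.
move=> td; set B := \matrix_(p < d, q < d) xrev (b p) q.
have cramer (l : 'I_d) :
    xrev (a s) l * minor b = \sum_m minor (upd b m (a s)) * xrev (b m) l.
  rewrite {1}minor.unlock -/B.
  pose y : 'rV_d := \row_q xrev (a s) q.
  have: y *m \adj B *m B = y *m (\det B)%:M by rewrite -mulmxA mul_adj_mx.
  move=> /matrixP /(_ 0 l); rewrite mul_mx_scalar [RHS]mxE [y 0 l]mxE mulrC
    => <-.
  rewrite [LHS]mxE; apply: eq_bigr => m _; rewrite [B m l]mxE; congr (_ * _).
  rewrite minor_upd [LHS]mxE; apply: eq_bigr => q _.
  by rewrite [y 0 q]mxE [\adj _ _ _]mxE.
rewrite (minor_row a s) mulr_suml.
under eq_bigr => q _.
  rewrite mulrAC (cramer (widen_ord td q)) mulr_suml; over.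
rewrite exchange_big; apply: eq_bigr => m _ /=.
rewrite [minor (upd a s _)]minor_upd mulr_suml; apply: eq_bigr => q _.
by rewrite -[LHS]mulrA [LHS]mulrC.
Qed.

(** On a minor with distinct rows a polarisation acts either by zero or by the
    exchange of two row labels. *)
Lemma polar_minor_inj i j m (a : 'I_m -> 'I_k) :
  injective a -> i != j -> j \in codom a ->
  polar i j (minor a) =
    if i \in codom a then 0 else minor (tperm i j \o a).
Proof.
move=> inj_a ij /codomP [s js]; rewrite js in ij *.
rewrite (@polar_minor_once _ _ _ _ s) // => [|p /inj_a //].
case: ifPn => [/codomP [u iu]|ia].
  have us : u != s by apply: contra_neq ij => <-.
  by rewrite (minor_dup us) // /upd eqxx (negPf us).
apply: eq_minor => p; rewrite /upd /=; have [->|ps] := eqVneq.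
  by rewrite tpermR.
rewrite tpermD //; first by apply: contraNneq ia => ->; exact: codom_f.
by rewrite (inj_eq inj_a) eq_sym.
Qed.

Lemma minor_swap_in i j m (a : 'I_m -> 'I_k) :
  injective a -> i != j -> i \in codom a -> j \in codom a ->
  minor (tperm i j \o a) = - minor a.
Proof.
move=> inj_a ij /codomP [s is_] /codomP [u ju].
have su : s != u by apply: contra_neq ij; rewrite is_ ju => ->.
rewrite -(minor_tperm a su); apply: eq_minor => p; rewrite /= is_ ju.
by rewrite -(inj_tperm _ _ _ inj_a).
Qed.

Lemma minor_swap_notin i j m (a : 'I_m -> 'I_k) :
  i \notin codom a -> j \notin codom a ->
  minor (tperm i j \o a) = minor a.
Proof.
move=> ia ja; apply: eq_minor => p /=; rewrite tpermD //.
  by apply: contraNneq ia => ->; exact: codom_f.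
by apply: contraNneq ja => ->; exact: codom_f.
Qed.

End Minors.

(** * The module generated by a product of two flag minors *)

Section Spanning.
Variables (C : numFieldType) (k n t d : nat) (w : 'I_t -> 'I_d).
Hypotheses (td : (t <= d)%N) (inj_w : injective w).
Variable V : polyM C k n -> Prop.
Hypothesis subV : is_submodule V.

Notation minor := (@minor C k n _).

Lemma submod0 : V 0. Proof. by case: subV. Qed.

Lemma submodD p q : V p -> V q -> V (p + q).
Proof. by case: subV => _ VL _ Vp Vq; rewrite -[p]scale1r; apply: VL. Qed.

Lemma submodZ c p : V p -> V (c *: p).
Proof. by case: subV => V0 VL _ Vp; rewrite -[_ *: _]addr0; apply: VL. Qed.

Lemma submodN p : V p -> V (- p).
Proof. by rewrite -scaleN1r; apply: submodZ. Qed.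

Lemma submod_polar i j p : V p -> V (polar i j p).
Proof.
case: subV => _ _ VH Vp; have := submodD (VH i j p Vp).
move=> /(_ (- ((n%:R / 2%:R *+ (i == j)) *: p))); rewrite /hop addrK.
by apply; apply/submodN/submodZ.
Qed.

(** Two row labels of a nested pair of minors may be exchanged: up to a
    nonzero factor, this either does nothing or is the effect of a
    polarisation.  The latter has to be applied twice when one label occurs in
    both minors and the other in neither, and this produces the factor 2. *)
Lemma submod_swap (b : 'I_d -> 'I_k) i j : injective b -> i != j ->
  V (minor (b \o w) * minor b) ->
  V (minor (tperm i j \o (b \o w)) * minor (tperm i j \o b)).
Proof.
move=> inj_b ij; have inj_a : injective (b \o w) by apply: inj_comp.
have ab l : l \in codom (b \o w) -> l \in codom b.
  by move=> /codomP [p ->]; apply: codom_f.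
move: (b \o w) inj_a ab => a inj_a ab.
have fst_out i' j' : tperm i j = tperm i' j' -> i' != j' ->
    i' \notin codom b -> j' \in codom b -> V (minor a * minor b) ->
    V (minor (tperm i j \o a) * minor (tperm i j \o b)).
  move=> -> {}ij ib jb Vab.
  have ia : i' \notin codom a by apply: contra ib => /ab.
  have eb : polar i' j' (minor b) = minor (tperm i' j' \o b).
    by rewrite polar_minor_inj // (negPf ib).
  case: (boolP (j' \in codom a)) => ja; last first.
    rewrite [minor (_ \o a)]minor_swap_notin // -eb -[_ * _]add0r.
    rewrite -[0](mul0r (minor b)) -(polar_minor_notin C n i' ja) -polarM.
    exact: submod_polar.
  have ea : polar i' j' (minor a) = minor (tperm i' j' \o a).
    by rewrite polar_minor_inj // (negPf ia).
  have out m (c : 'I_m -> 'I_k) : i' \notin codom c ->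
      polar i' j' (minor (tperm i' j' \o c)) = 0.
    move=> ic; apply: polar_minor_notin; apply: contra ic => /codomP [p /=].
    by move=> /(congr1 (tperm i' j')); rewrite tpermK tpermR => ->;
      apply: codom_f.
  (* Twice the same derivation: only the mixed terms survive. *)
  have := submod_polar i' j' (submod_polar i' j' Vab).
  rewrite polarM ea eb polarD !polarM ea eb !out // mul0r mulr0 add0r addr0.
  rewrite -mulr2n -scaler_nat => /(submodZ 2^-1); rewrite scalerA mulVf ?scale1r
    //.
  by rewrite pnatr_eq0.
have fst_in i' j' : tperm i j = tperm i' j' -> i' != j' ->
    i' \in codom b -> i' \notin codom a -> j' \in codom a ->
    V (minor a * minor b) ->
    V (minor (tperm i j \o a) * minor (tperm i j \o b)).
  move=> -> {}ij ib ia ja Vab; have jb := ab _ ja.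
  rewrite [minor (_ \o b)]minor_swap_in // mulrN; apply: submodN.
  move: (submod_polar i' j' Vab).
  by rewrite polarM !polar_minor_inj // (negPf ia) ib mulr0 addr0.
have tC := tpermC i j; have ji : j != i by rewrite eq_sym.
move=> Vab.
case: (boolP (i \in codom b)) => ib; case: (boolP (j \in codom b)) => jb.
- case: (boolP (i \in codom a)) => ia; case: (boolP (j \in codom a)) => ja.
  + by rewrite !minor_swap_in // mulrNN.
  + exact: (fst_in j i).
  + exact: (fst_in i j).
  + by rewrite minor_swap_notin // [minor (_ \o b)]minor_swap_in // mulrN;
    apply: submodN.
- exact: (fst_out j i).
- exact: (fst_out i j).
- by rewrite !minor_swap_notin //; apply: contra ib + apply: contra jb;
  apply: ab.
Qed.

(** Descending induction on the number of labels on which [b] and [b0]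
    disagree: exchanging [b s] with [b0 s] repairs the position [s] and leaves
    every position of agreement alone. *)
Lemma submod_flag (b0 b : 'I_d -> 'I_k) : injective b0 -> injective b ->
  V (minor (b0 \o w) * minor b0) -> V (minor (b \o w) * minor b).
Proof.
move=> inj0 + V0; have [N] := ubnP #|[pred p | b p != b0 p]|.
elim: N b => // N IH b leN inj_b.
case: (pickP [pred p | b p != b0 p]) => [s /= bs|b_b0]; last first.
  have bb p : b p = b0 p by apply/eqP/negbNE/negbT/b_b0.
  by rewrite (eq_minor _ _ (b := b0)) //
    (eq_minor _ _ (a := b \o w) (b := b0 \o w)) // => p /=.
pose u := tperm (b s) (b0 s).
have inj_ub : injective (u \o b) by apply: inj_comp => //; apply: perm_inj.
have := submod_swap inj_ub bs (IH (u \o b) _ inj_ub).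
have ubK : tperm (b s) (b0 s) \o (u \o b) = b.
  by apply/funext => p; rewrite /= tpermK.
rewrite -[tperm _ _ \o (_ \o w)]/((tperm (b s) (b0 s) \o (u \o b)) \o w) ubK.
apply; rewrite ltnS in leN; apply: leq_trans _ leN; apply/proper_card/properP;
  split.
  apply/fintype.subsetP => p; rewrite !inE; apply: contraNneq => bp.
  have ps : p != s by apply: contraNneq bs => <-; apply/eqP.
  by rewrite /u /= tpermD // ?bp ?(inj_eq inj0) ?(inj_eq inj_b) 1?eq_sym // -bp
    (inj_eq inj_b).
by exists s; rewrite !inE /u /= ?tpermL ?eqxx.
Qed.

(** The part of a Young symmetriser for columns of lengths [d] and [t] is
    played by an induction on the number of positions at which [a] differs from
    [b \o w].  At such a position [s] there are two cases.
    If [a s] is a row of [b], reordering the rows of [b] removes the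
    disagreement.  Otherwise expand the product by the exchange relation at
    [s].  A term that moves into [a] a row already present there is zero.  Any
    other term is congruent to the opposite of the product itself: the
    polarisation from [b m] to [a s] of a product with fewer disagreements is
    the sum of the two.  Hence a positive multiple of the product lies in
    [V]. *)
Lemma submod_minors (b0 : 'I_d -> 'I_k) : injective b0 ->
  V (minor (b0 \o w) * minor b0) ->
  forall (a : 'I_t -> 'I_k) (b : 'I_d -> 'I_k), V (minor a * minor b).
Proof.
move=> inj0 V0 a b; have [N] := ubnP #|[pred p | a p != b (w p)]|.
elim: N a b => // N IH a b leN.
case: (pselect (injective a)) => [inj_a|/(@minor_inj C k n _ _) ->]; last first.
  by rewrite mul0r; apply: submod0.
case: (pselect (injective b)) => [inj_b|/(@minor_inj C k n _ _) ->]; last first.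
  by rewrite mulr0; apply: submod0.
case: (pickP [pred p | a p != b (w p)]) => [s /= as_|ab]; last first.
  rewrite (eq_minor _ _ (a := a) (b := b \o w)); first exact: submod_flag V0.
  by move=> p; apply/eqP/negbNE/negbT/ab.
(* Reordering the rows of [b] only changes the sign. *)
have reorder a' m :
    a' s = b m ->
    (forall p, p != s -> a p = b (w p) -> a' p = b (w p) /\ w p != m) ->
    V (minor a' * minor b).
  move=> a's a'p; have V1 : V (minor a' * minor (b \o tperm (w s) m)).
    apply: IH; rewrite ltnS in leN; apply: leq_trans _ leN;
      apply/proper_card/properP; split.
      apply/fintype.subsetP => p; rewrite !inE; apply: contraNneq => ap.
      have ps : p != s by apply: contraNneq as_ => <-; apply/eqP.
      have [-> wpm] := a'p p ps ap.
      by rewrite /= tpermD // 1?eq_sym // (inj_eq inj_w).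
    by exists s; rewrite !inE //= tpermL a's eqxx.
  have [wsm|wsm] := eqVneq (w s) m.
    rewrite (eq_minor _ _ (a := b) (b := b \o tperm (w s) m)) // => p /=.
    by rewrite wsm tperm1 perm1.
  by rewrite -[minor b]opprK -(minor_tperm _ _ _ wsm) mulrN; apply: submodN.
case: (boolP (a s \in codom b)) => [/codomP [m asm]|asb].
  apply: (reorder a m asm) => p ps ap; split=> //.
  by apply: contraNneq ps => wpm; apply/eqP/inj_a; rewrite ap asm wpm.
pose T m := minor (upd a s (b m)) * minor (upd b m (a s)).
have TV m : V (T m + (b m \notin codom a)%:R *: (minor a * minor b)).
  have [bma|bma] := boolP (b m \in codom a); rewrite ?scale0r ?scale1r ?addr0.
    have /codomP [p bmp] := bma; rewrite /T (minor_dup _ _ (p := p) (q := s)).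
    + by rewrite mul0r; apply: submod0.
    + by apply: contraNneq asb => <-; rewrite -bmp codom_f.
    + by rewrite /upd eqxx bmp; case: eqP.
  have := @submod_polar (a s) (b m) _ (reorder (upd a s (b m)) m _ _).
  rewrite polarM (@polar_minor_once _ _ _ _ _ _ (upd _ _ _) s); first last.
  - move=> p; rewrite /upd; case: eqP => // _ apb.
    by rewrite -apb codom_f in bma.
  - by rewrite /upd eqxx.
  rewrite (@polar_minor_once _ _ _ _ _ _ b m) // => [|p /inj_b //].
  have -> : upd (upd a s (b m)) s (a s) = a.
    by apply/funext => p; rewrite /upd; case: eqP => // ->.
  rewrite addrC; apply; first by rewrite /upd eqxx.
  move=> p ps ap; rewrite /upd (negPf ps); split=> //.
  by apply: contraNneq bma => <-; rewrite -ap codom_f.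
have : V (\sum_m (T m + (b m \notin codom a)%:R *: (minor a * minor b))).
  by elim/big_rec: _ => [|m p _ Vp]; [apply: submod0 | apply: submodD].
rewrite big_split /= -exchange_minors // -scaler_suml -natr_sum.
rewrite -[X in X + _]scale1r.
rewrite -scalerDl nat1r; set c := (\sum_i _)%N.
move=> /(submodZ c.+1%:R^-1); rewrite scalerA mulVf ?scale1r.
  exact.
by rewrite pnatr_eq0.
Qed.

End Spanning.

(** * Harmonicity of products of minors *)

Section Harmonicity.
Variables (C : numFieldType) (k n : nat).
Implicit Types (i j : 'I_k) (l : 'I_n).

Notation xrev := (@xrev C k n).
Notation minor := (@minor C k n _).

Definition rowdet m (f : 'I_m -> nat -> polyM C k n) : polyM C k n :=
  \det (\matrix_(p < m, q < m) f p q).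

Lemma eq_rowdet m (f g : 'I_m -> nat -> polyM C k n) :
  (forall p (q : 'I_m), f p q = g p q) -> rowdet f = rowdet g.
Proof. by move=> fg; congr (\det _); apply/matrixP => p q; rewrite !mxE fg. Qed.

Lemma rowdet_row0 m (f : 'I_m -> nat -> polyM C k n) s :
  (forall q : 'I_m, f s q = 0) -> rowdet f = 0.
Proof.
move=> fs0; rewrite /rowdet (expand_det_row _ s) big1 // => q _.
by rewrite mxE fs0 mul0r.
Qed.

Lemma rowdet_swap m (f : 'I_m -> nat -> polyM C k n) s r x y : r != s ->
  rowdet (upd (upd f s x) r y) = - rowdet (upd (upd f s y) r x).
Proof.
move=> rs; rewrite -mulN1r.
have -> : -1 = \det (@perm_mx (polyM C k n) _ (tperm s r)).
  by rewrite det_perm odd_tperm eq_sym rs.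
rewrite /rowdet -det_mulmx -row_permE; congr (\det _).
apply/matrixP => p q; rewrite [RHS]mxE [LHS]mxE [RHS]mxE /upd.
have [->|pr] := eqVneq p r; first by rewrite tpermR eq_sym (negPf rs) eqxx.
have [->|ps] := eqVneq p s; first by rewrite tpermL eqxx.
rewrite tpermD; [|by rewrite eq_sym..].
by rewrite (negPf pr) (negPf ps).
Qed.

Lemma dx_rowdet i l m (f : 'I_m -> nat -> polyM C k n) :
  dx i l (rowdet f) = \sum_s rowdet (upd f s (fun q => dx i l (f s q))).
Proof.
rewrite /rowdet (der_det_row (@dxD C k n i l) (@dxM C k n i l)).
apply: eq_bigr => s _; congr (\det _); apply/matrixP => p q; rewrite !mxE /upd.
by have [->|] := eqVneq p s.
Qed.

(** The derivative of a row [xrev i], up to the test that [i] is the right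
    row. *)
Definition unit_row l (q : nat) : polyM C k n := (rev_ord l == q :> nat)%:R.

Lemma dx_unit_row i l l' q : dx i l (unit_row l' q) = 0.
Proof.
rewrite /unit_row; case: (_ == _); last exact: der0 (@dxD C k n i l).
exact: der1 (@dxM C k n i l).
Qed.

Lemma dx_xrev i l j q : (q < n)%N ->
  dx i l (xrev j q) = if j == i then unit_row l q else 0.
Proof.
move=> qn; rewrite (xrev_ord C j (Ordinal qn)) dx_gen.
have -> : (l == rev_ord (Ordinal qn)) = (rev_ord l == q :> nat).
  by rewrite -(inj_eq rev_ord_inj) rev_ordK.
by rewrite eq_sym; case: (j == i).
Qed.

Lemma dx_minor i l m (a : 'I_m -> 'I_k) : (m <= n)%N ->
  dx i l (minor a) =
  \sum_(s | a s == i) rowdet (upd (fun p => xrev (a p)) s (unit_row l)).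
Proof.
move=> mn; rewrite minor.unlock -/(rowdet (fun p => xrev (a p))) dx_rowdet.
rewrite [RHS]big_mkcond; apply: eq_bigr => s _.
have E (q : 'I_m) := dx_xrev i l (a s) (leq_trans (ltn_ord q) mn).
case: ifPn => as_i; last first.
  by apply: (rowdet_row0 (s := s)) => q; rewrite /upd eqxx E (negPf as_i).
by apply: eq_rowdet => p q; rewrite /upd; case: eqP => // _; rewrite E as_i.
Qed.

Lemma dx_minor_eq0 i l m (a : 'I_m -> 'I_k) : (m <= n)%N ->
  (m <= rev_ord l)%N -> dx i l (minor a) = 0.
Proof.
move=> mn ml; rewrite dx_minor // big1 // => s _.
apply: (rowdet_row0 (s := s)) => q; rewrite /upd eqxx /unit_row.
by rewrite gtn_eqF // (leq_trans (ltn_ord q)).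
Qed.

Lemma dx_dx_minor i j l l' m (a : 'I_m -> 'I_k) : (m <= n)%N ->
  dx i l (dx j l' (minor a)) =
  \sum_(s | a s == j) \sum_(r | (r != s) && (a r == i))
    rowdet (upd (upd (fun p => xrev (a p)) s (unit_row l')) r (unit_row l)).
Proof.
move=> mn; rewrite dx_minor // (der_sum (@dxD C k n i l)).
apply: eq_bigr => s _; rewrite dx_rowdet [RHS]big_mkcond.
apply: eq_bigr => r _; have [->|rs] /= := eqVneq r s.
  apply: (rowdet_row0 (s := s)) => q; rewrite /upd !eqxx.
  exact: dx_unit_row.
have E (q : 'I_m) := dx_xrev i l (a r) (leq_trans (ltn_ord q) mn).
case: ifPn => ar_i; last first.
  by apply: (rowdet_row0 (s := r)) => q; rewrite /upd eqxx (negPf rs) E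
    (negPf ar_i).
by apply: eq_rowdet => p q; rewrite /upd; case: (p == r);
  rewrite ?(negPf rs) ?E ?ar_i.
Qed.

(** Two partial derivatives replace two different rows by unit rows;
    interchanging the columns [l] and [l'] interchanges these unit rows. *)
Lemma dx_dx_minor_anti i j l l' m (a : 'I_m -> 'I_k) : (m <= n)%N ->
  dx i l (dx j l' (minor a)) = - dx i l' (dx j l (minor a)).
Proof.
move=> mn; rewrite !dx_dx_minor // -sumrN; apply: eq_bigr => s _.
by rewrite -sumrN; apply: eq_bigr => r /andP [rs _]; apply: rowdet_swap.
Qed.

(** The sum over [l] in the Laplacian is antisymmetric under the reversal of
    the columns. *)
Lemma harmonic_minor m (a : 'I_m -> 'I_k) : (m <= n)%N -> harmonic (minor a).
Proof.
move=> mn i j; set S := laplacian _ _ _.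
suff: S = - S.
  move=> SN; have: 2%:R *: S = 0 by rewrite scaler_nat mulr2n {1}SN addNr.
  by move/eqP; rewrite scaler_eq0 pnatr_eq0 => /eqP.
rewrite {1}/S /laplacian (reindex_inj rev_ord_inj) -sumrN /=.
by apply: eq_bigr => l _; rewrite rev_ordK dx_dx_minor_anti.
Qed.

(** The mixed terms of the product rule vanish because the last [t] columns
    and the reversals of the last [d] columns are disjoint. *)
Lemma harmonic_minors t d (a : 'I_t -> 'I_k) (b : 'I_d -> 'I_k) :
  (t + d <= n)%N -> harmonic (minor a * minor b).
Proof.
move=> tdn i j.
have tn : (t <= n)%N := leq_trans (leq_addr _ _) tdn.
have dn : (d <= n)%N := leq_trans (leq_addl _ _) tdn.
rewrite /laplacian.
under eq_bigr => l _.
  rewrite dxM dxD !dxM.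
  have -> : dx j (rev_ord l) (minor a) * dx i l (minor b) = 0.
    have [tl|lt] := leqP t (rev_ord (rev_ord l)).
      by rewrite (dx_minor_eq0 _ _ _ tl) // mul0r.
    rewrite (@dx_minor_eq0 i l _ b) ?mulr0 //.
    move: lt; rewrite rev_ordK /=; lia.
  have -> : dx i l (minor a) * dx j (rev_ord l) (minor b) = 0.
    have [tl|lt] := leqP t (rev_ord l).
      by rewrite (dx_minor_eq0 _ _ _ tl) // mul0r.
    rewrite (@dx_minor_eq0 j _ _ b) ?mulr0 // rev_ordK.
    move: lt => /=; have := ltn_ord l; lia.
  rewrite addr0 add0r; over.
rewrite big_split /= -mulr_suml -mulr_sumr.
rewrite -/(laplacian i j (minor a)) -/(laplacian i j (minor b)).
by rewrite !harmonic_minor // mul0r mulr0 addr0.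
Qed.

End Harmonicity.

(** * Bordered determinants *)

Section BlockDeterminant.
Variables (S : comNzRingType) (k t d : nat).
Variables (F : 'I_k -> 'I_k -> S) (X : 'I_k -> nat -> S).

(** The labels [a] and [b] are total functions on the natural numbers, so that
    deleting a row or a column is a composition with [bump]; the size [N] is
    kept apart from [p] and [q] because the sizes that occur agree only
    propositionally. *)
Definition bordered_mx N p q (a b : nat -> 'I_k) : 'M[S]_N :=
  \matrix_(i, j)
    if (i < p)%N then if (j < q)%N then F (a i) (b j) else X (a i) (j - q)
    else if (j < q)%N then X (b j) (i - p) else 0.

Lemma sum_const_lt (N p : nat) (x : S) : (p <= N)%N ->
  \sum_(i < N | (i < p)%N) x = x *+ p.
Proof. by move=> pN; rewrite -(big_ord_widen N (fun=> x) pN) sumr_const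
  card_ord. Qed.

(** Sum the Laplace expansions along the first [p] rows, and subtract the
    expansions along the last [N - q] columns: because of the zero block the
    latter only involve the first [p] rows, so what remains is the sum over
    the upper left block.  The coefficient [p + q - N] is moved to the other
    side to avoid a subtraction. *)
Lemma bordered_expand N p q a b : (p <= N)%N -> (q <= N)%N ->
  let A := bordered_mx N p q a b in
  \det A *+ p + \det A *+ q =
  \sum_(i < N | (i < p)%N) \sum_(j < N | (j < q)%N)
    F (a i) (b j) * cofactor A i j
  + \det A *+ N.
Proof.
move=> pN qN A.
have E : \sum_(j < N | ~~ (j < q)%N) \det A =
    \sum_(j < N | ~~ (j < q)%N) \sum_(i < N | (i < p)%N) A i j * cofactor A i j.
  apply: eq_bigr => j jq; rewrite (expand_det_col A j)
    (bigID (fun i : 'I_N => i < p)%N) /=.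
  rewrite [X in _ + X]big1 ?addr0 // => i ip.
  by rewrite mxE (negPf ip) (negPf jq) mul0r.
have <- : \det A *+ q + \sum_(j < N | ~~ (j < q)%N) \det A = \det A *+ N.
  rewrite -(sum_const_lt _ qN) -(bigID (fun j : 'I_N => j < q)%N predT) /=.
  by rewrite sumr_const card_ord.
rewrite addrCA [LHS]addrC; congr (_ + _);
  rewrite E [\sum_(j < N | ~~ _) _]exchange_big -(sum_const_lt _ pN) /=.
rewrite -big_split; apply: eq_bigr => i ip /=.
rewrite (expand_det_row A i) (bigID (fun j : 'I_N => j < q)%N) /=;
  congr (_ + _).
by apply: eq_bigr => j jq; rewrite mxE ip jq.
Qed.

Lemma cofactor_bordered N p q a b (i j : 'I_N.+1) :
  (i < p.+1)%N -> (j < q.+1)%N ->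
  cofactor (bordered_mx N.+1 p.+1 q.+1 a b) i j =
  (-1) ^+ (i + j) * \det (bordered_mx N p q (a \o bump i) (b \o bump j)).
Proof.
move=> ip jq; congr (_ * \det _); apply/matrixP => r s; rewrite !mxE /=.
have lt_bump (h x y : nat) : (h < y.+1)%N -> (bump h x < y.+1)%N = (x < y)%N.
  by rewrite /bump; lia.
have sub_bump (h x y : nat) : (h < y.+1)%N -> (y <= x)%N ->
    (bump h x - y.+1 = x - y)%N by rewrite /bump; lia.
rewrite !lt_bump //; case: ltnP => rp; case: ltnP => sq //; by rewrite sub_bump.
Qed.

Definition swap_col_blocks (j : 'I_(t + d)) : 'I_(t + d) :=
  cast_ord (addnC d t)
    match split j with inl j' => rshift d j' | inr j' => lshift t j' end.

Lemma swap_col_blocks_inj : injective swap_col_blocks.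
Proof.
move=> i j /cast_ord_inj; rewrite -{2}[ i ]splitK -{2}[j]splitK.
case: (split i) => i'; case: (split j) => j' /= /eqP.
- by rewrite eq_rshift => /eqP ->.
- by rewrite eq_rlshift.
- by rewrite eq_lrshift.
- by rewrite eq_lshift => /eqP ->.
Qed.

Lemma det_bordered0 a b :
  \det (bordered_mx (t + d) t d a b) =
  (-1) ^+ perm swap_col_blocks_inj *
  (\det (\matrix_(i < t, l < t) X (a i) l) *
   \det (\matrix_(j < d, l < d) X (b j) l)).
Proof.
set A := bordered_mx _ _ _ _ _; set s := perm _.
have : \det (col_perm s A) = (-1) ^+ s * \det A.
  by rewrite col_permE det_mulmx det_perm odd_permV mulrC.
have -> : col_perm s A = block_mx (\matrix_(i < t, l < t) X (a i) l)
    (\matrix_(i < t, j < d) F (a i) (b j)) 0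
    (\matrix_(j < d, l < d) X (b j) l)^T.
  apply/matrixP => i j; rewrite -[ i ]splitK -[j]splitK.
  rewrite mxE permE /swap_col_blocks !unsplitK.
  case: (split i) => i'; case: (split j) => j';
    rewrite /= ?block_mxEul ?block_mxEur ?block_mxEdl ?block_mxEdr !mxE /=.
  - by rewrite ltn_ord ltnNge leq_addr addKn.
  - by rewrite !ltn_ord.
  - by rewrite ltnNge leq_addr ltnNge leq_addr.
  - by rewrite ltnNge leq_addr ltn_ord addKn.
by rewrite det_ublock det_tr => ->; rewrite signrMK.
Qed.

(** With [p = m + t] and [q = m + d] the expansion above writes [m] times the
    determinant as a combination of the entries of the upper left block, with
    smaller determinants of the same form as coefficients.  At [m = 0] the
    determinant is the product of those of the two borders.  This is the
    generalised Laplace expansion without its bookkeeping of row and column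
    subsets; the price is a division by [m.+1]. *)
Lemma bordered_ind (W : S -> Prop) :
    W 0 -> (forall x y, W x -> W y -> W (x + y)) ->
    (forall x, W x -> W (- x)) ->
    (forall m x, W (x *+ m.+1) -> W x) ->
    (forall i j x, W x -> W (F i j * x)) ->
    (forall a b : nat -> 'I_k,
       W (\det (\matrix_(i < t, l < t) X (a i) l) *
          \det (\matrix_(j < d, l < d) X (b j) l))) ->
  forall m N a b, N = (m + (t + d))%N ->
    W (\det (bordered_mx N (m + t) (m + d) a b)).
Proof.
move=> W0 WD WN Wdiv WF Wbase m.
have Wsign (e : nat) x : W x -> W ((-1) ^+ e * x).
  by rewrite -signr_odd mulr_sign => Wx; case: odd => //; apply: WN.
elim: m => [|m IH] N a b ->; first by rewrite det_bordered0; apply: Wsign.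
set p := (m + t)%N; set q := (m + d)%N.
have pN : (p.+1 <= m.+1 + (t + d))%N by rewrite /p; lia.
have qN : (q.+1 <= m.+1 + (t + d))%N by rewrite /q; lia.
apply: (Wdiv m); have := bordered_expand a b pN qN.
rewrite /= -mulrnDr -(_ : (m.+1 + (m.+1 + (t + d)) = p.+1 + q.+1)%N);
  last by rewrite /p /q; lia.
rewrite mulrnDr => /addIr ->.
apply: (big_ind W) => // i ip; apply: (big_ind W) => // j jq; apply: WF.
by rewrite cofactor_bordered //; apply/Wsign/IH.
Qed.

End BlockDeterminant.

(** * Invariants, and the module of a diagram with two columns *)

Section TensorMembership.
Variables (C : numFieldType) (k n : nat).
Implicit Types (i j : 'I_k).

Notation minor := (@minor C k n _).

Lemma orth_act_gen g i (l : 'I_n) :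
  orth_act g (gen_mx C k n i l) = \sum_p gen_mx C k n i p * (g p l)%:MP.
Proof.
rewrite /orth_act [gen_mx C k n i l]mxE mmapX mmap1U mxvecE mxE.
by apply: eq_bigr => p _; rewrite [map_mx _ _ _ _]mxE.
Qed.

Lemma orthogonal_mx_gram (g : 'M[C]_n) p q : orthogonal_mx g ->
  \sum_l g p l * g q (rev_ord l) = (q == rev_ord p)%:R.
Proof.
move=> /(_ (delta_mx 0 p) (delta_mx 0 q)); rewrite /bform -!rowE.
under eq_bigr do rewrite !mxE; move=> ->.
rewrite (bigD1 p) //= big1 => [|l /negPf lp]; rewrite !mxE ?eqxx ?lp ?mul0r //.
by rewrite addr0 mul1r eq_sym.
Qed.

Lemma O_invariant_rform i j : O_invariant (rform C n i j).
Proof.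
move=> g og; rewrite /rform /orth_act rmorph_sum /=.
under eq_bigr => l _ do rewrite rmorphM /= -!/(orth_act _ _) !orth_act_gen
  mulr_suml.
rewrite exchange_big; apply: eq_bigr => p _ /=.
under eq_bigr => l _ do rewrite mulr_sumr.
rewrite exchange_big (bigD1 (rev_ord p)) //= [X in _ + X]big1 ?addr0 => [|q qp].
  under eq_bigr => l _ do rewrite mulrACA -mpolyCM.
  by rewrite -mulr_sumr -raddf_sum orthogonal_mx_gram // eqxx mulr1.
under eq_bigr => l _ do rewrite mulrACA -mpolyCM.
by rewrite -mulr_sumr -raddf_sum orthogonal_mx_gram // (negPf qp) raddf0 mulr0.
Qed.

Lemma O_invariantM (p q : polyM C k n) :
  O_invariant p -> O_invariant q -> O_invariant (p * q).
Proof. by move=> Ip Iq g og; rewrite /orth_act rmorphM /= -!/(orth_act _ _) Ip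
  ?Iq. Qed.

Lemma O_invariant1 : O_invariant (1 : polyM C k n).
Proof. by move=> g og; rewrite /orth_act rmorph1. Qed.

Lemma in_tensor_map (A B : polyM C k n -> Prop)
  (f g : polyM C k n -> polyM C k n)
    (h : polyMM C k n -> polyMM C k n) z :
  {morph h : x y / x + y} -> h 0 = 0 ->
  (forall p, A p -> A (f p)) -> (forall p, B p -> B (g p)) ->
  (forall p q, h (tens p q) = tens (f p) (g q)) ->
  in_tensor A B z -> in_tensor A B (h z).
Proof.
move=> hD h0 Af Bg hE [s [sAB ->]]; exists [seq (f pq.1, g pq.2) | pq <- s];
  split.
  by move=> _ /mapP [pq /sAB [Apq Bpq] ->]; split; [apply: Af | apply: Bg].
by rewrite big_map (big_morph h hD h0); apply: eq_bigr => pq _; rewrite hE.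
Qed.

Lemma in_tensor0 (A B : polyM C k n -> Prop) : in_tensor A B 0.
Proof. by exists [::]; rewrite big_nil. Qed.

Lemma in_tensorD (A B : polyM C k n -> Prop) y z :
  in_tensor A B y -> in_tensor A B z -> in_tensor A B (y + z).
Proof.
move=> [s [sAB ->]] [u [uAB ->]]; exists (s ++ u); rewrite big_cat;
  split=> // pq.
by rewrite mem_cat => /orP [/sAB|/uAB].
Qed.

Lemma in_tensorS (A B B' : polyM C k n -> Prop) z :
  (forall p, B p -> B' p) -> in_tensor A B z -> in_tensor A B' z.
Proof.
by move=> BB' [s [sAB ->]]; exists s; split=> // pq /sAB [? /BB'].
Qed.

Lemma tensZr (c : C) (p q : polyM C k n) :
  tens p (c *: q) = (c%:MP)%:MP * tens p q.
Proof. by rewrite /tens /tensr map_mpolyZ -mul_mpolyC mulrCA. Qed.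

Lemma in_tensorZ (A B : polyM C k n -> Prop) (c : C) z :
  (forall p, B p -> B (c *: p)) -> in_tensor A B z ->
  in_tensor A B ((c%:MP)%:MP * z).
Proof.
move=> BZ; apply: (in_tensor_map (f := id)) => [x y||//|p|p q].
- exact: mulrDr.
- exact: mulr0.
- exact: BZ.
- by rewrite tensZr.
Qed.

(** Reversing rows and columns costs the same sign twice. *)
Lemma det_rev (S : comNzRingType) m (A : 'M[S]_m) :
  \det (\matrix_(i, j) A (rev_ord i) (rev_ord j)) = \det A.
Proof.
pose r := perm (@rev_ord_inj m).
rewrite (_ : matrix_of_fun _ _ = row_perm r (col_perm r A)); last first.
  by apply/matrixP => i j; rewrite !mxE !permE.
rewrite row_permE col_permE !det_mulmx !det_perm odd_permV mulrCA.
by rewrite -signr_addb addbb mulr1.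
Qed.

Lemma delta_minor m (mk : (m <= k)%N) : (m <= n)%N ->
  delta C k n m = minor (fun p : 'I_m => rev_ord (widen_ord mk p)).
Proof.
move=> mn; rewrite minor.unlock -[RHS]det_rev; congr (\det _);
  apply/matrixP => p q.
rewrite [LHS]mxE [RHS]mxE [RHS]mxE /xrev /=; have := ltn_ord p;
  have := ltn_ord q.
by move=> qm pm; congr mxat; lia.
Qed.

Lemma nth_two_columns t d e : (t <= d)%N ->
  nth 0%N (nseq t 2%N ++ nseq (d - t) 1%N) e = ((e < t) + (e < d))%N.
Proof.
move=> td; rewrite nth_cat size_nseq !nth_nseq.
by case: ltnP => te; [rewrite (leq_trans te td) | rewrite ltn_subLR // subnKC
  //; case: ltnP].
Qed.

Lemma delta_two_columns t d : (t <= d)%N -> (d <= minn n k)%N ->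
  delta_diagram C k n (nseq t 2%N ++ nseq (d - t) 1%N) =
  delta C k n t * delta C k n d.
Proof.
move=> td dm.
have delta0 : delta C k n 0 = 1 by rewrite /delta det_mx00.
have pick e : (e <= minn n k)%N ->
    \prod_(1 <= m < (minn n k).+1) delta C k n m ^+ (m == e) = delta C k n e.
  move=> em; have := @big_ltn _ 1 *%R 0 (minn n k).+1
    (fun m => delta C k n m ^+ (m == e)) isT.
  rewrite delta0 expr1n mul1r => <-.
  rewrite big_mkord (bigD1 (Ordinal (n := (minn n k).+1) em)) //= eqxx expr1
    big1 ?mulr1 // => l.
  by rewrite -val_eqE => /negPf /= ->.
rewrite -pick ?(leq_trans td) // -[X in _ = _ * X]pick // -big_split /=.
rewrite /delta_diagram !big_nat; apply: eq_bigr => j /andP [j_gt0 _].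
by rewrite -exprD !nth_two_columns //; congr (_ ^+ _); lia.
Qed.

(** [delta_diagram] is itself the product of the minors on the bottom [t] and
    the bottom [d] rows, so the module it generates contains all products. *)
Lemma in_F_minors t d (a : 'I_t -> 'I_k) (b : 'I_d -> 'I_k) :
  (t <= d)%N -> (d <= minn n k)%N ->
  in_F (nseq t 2%N ++ nseq (d - t) 1%N) (minor a * minor b).
Proof.
move=> td dm V subV; rewrite delta_two_columns //.
have dk : (d <= k)%N by apply: leq_trans dm (geq_minr _ _).
have inj_b : injective (fun p : 'I_d => rev_ord (widen_ord dk p)).
  by move=> p q /rev_ord_inj /(congr1 val) /= /val_inj.
have inj_w : injective (widen_ord td) by move=> p q /(congr1 val) /= /val_inj.
have dn : (d <= n)%N by apply: leq_trans dm (geq_minl _ _).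
rewrite (delta_minor dk) // (delta_minor (leq_trans td dk)) ?(leq_trans td) //
  => Vdelta.
apply: (submod_minors td inj_w subV inj_b).
congr (V (_ * _)): Vdelta; apply: eq_minor => p; exact/val_inj.
Qed.

End TensorMembership.

(** * The weight of the determinant *)

Section RootCombinatorics.
Variables (n t d : nat).
Hypotheses (td : (t <= d)%N) (tdn : (t + d <= n)%N).
Notation k := n.+1.
Implicit Types (i j p q : 'I_k) (u : 'rV[rat]_k).

Notation two_columns := (nseq t 2%N ++ nseq (d - t) 1%N).
Notation lam := (sharp n k two_columns).

(** The coordinates of [lam + rho], shifted by [1 + n / 2] to become natural
    numbers.  They exhaust the interval from [0] to [n + 2] except for [t] and
    [d + 1], and the root [eps i + eps j] is orthogonal to [lam + rho] exactly
    when the values at [i] and [j] are mirror images in this interval. *)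
Definition shifted i : nat := (n.+2 - i - (n - d < i) - (n - t < i))%N.

Lemma lam_rhoE i : (lam + rho k) 0 i = (shifted i)%:R - 1 - n%:R / 2%:R.
Proof.
rewrite !mxE nth_two_columns // /=; have in_ := ltn_ord i.
have : (shifted i + ((n.+1 - i.+1 < t) + (n.+1 - i.+1 < d)) = (k - i).+1)%N.
  by rewrite /shifted; lia.
move=> /(congr1 (fun x : nat => x%:R : rat)).
rewrite !natrD -[X in _ = X]natr1 => E.
by move: (shifted i)%:R E => x E; lra.
Qed.

Lemma shifted_inj : injective shifted.
Proof.
move=> i j; have := ltn_ord i; have := ltn_ord j; rewrite /shifted => ? ? ?.
apply/val_inj => /=; lia.
Qed.

Lemma shifted_surj x : (x <= n.+2)%N -> x != t -> x != d.+1 ->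
  exists i, shifted i = x.
Proof.
move=> xn xt xd; rewrite /shifted.
have [dx|xd'] := ltnP d x.
  have ik : (n.+2 - x < k)%N by lia.
  by exists (Ordinal ik) => /=; lia.
have [tx|xt'] := ltnP t x.
  have ik : (n.+1 - x < k)%N by lia.
  by exists (Ordinal ik) => /=; lia.
have ik : (n - x < k)%N by lia.
by exists (Ordinal ik) => /=; lia.
Qed.

Lemma shifted_range i :
  [&& (shifted i <= n.+2)%N, shifted i != t & shifted i != d.+1].
Proof. by have := ltn_ord i; rewrite /shifted; lia. Qed.

Lemma dot_eps2 i j u : dot (eps i + eps j) u = u 0 i + u 0 j.
Proof.
rewrite /dot; under eq_bigr => l _ do rewrite !mxE mulrDl.
rewrite big_split /= (bigD1 i) //= big1 => [|l /negPf li];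
  last by rewrite li mul0r.
rewrite (bigD1 j) //= [X in _ + (_ + X)]big1 => [|l /negPf lj];
  last by rewrite lj mul0r.
by rewrite !eqxx !mul1r !addr0.
Qed.

Lemma dotC u v : dot u v = dot v u :> rat.
Proof. by apply: eq_bigr => i _; rewrite mulrC. Qed.

Lemma dotZr c u v : dot u (c *: v) = c * dot u v :> rat.
Proof. by rewrite /dot mulr_sumr; apply: eq_bigr => i _; rewrite !mxE mulrCA.
Qed.

Lemma eps2E i j l : (eps i + eps j) 0 l = (l == i)%:R + (l == j)%:R :> rat.
Proof. by rewrite !mxE eqxx. Qed.

Lemma dot_coroot_eps2 u i j :
  dot u (coroot (eps i + eps j)) = (u 0 i + u 0 j) / (if i == j then 2 else 1).
Proof.
rewrite /coroot dotZr dotC !dot_eps2 !eps2E !eqxx [j == i]eq_sym.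
by case: eqP => _ /=; field.
Qed.

Lemma long_eps i : is_long (eps i + eps i).
Proof. by exists i, false; rewrite expr0 scale1r. Qed.

Lemma long_not_short i : ~ is_short (eps i + eps i).
Proof.
move=> [a [b [x [y [ab E]]]]].
have ab' : a == b = false by apply/eqP => ab'; rewrite ab' ltnn in ab.
have nz z : (-1 : rat) ^+ (z : bool) != 0 by rewrite signr_eq0.
have := congr1 (fun v : 'rV[rat]_k => v 0 a) E.
have := congr1 (fun v : 'rV[rat]_k => v 0 b) E.
rewrite !mxE !eqxx /= [b == a]eq_sym ab' /= !mulr0 !mulr1 add0r addr0.
case: (eqVneq b i) => [<-|_]; last by move=> /esym /eqP;
  rewrite addr0 (negPf (nz _)).
by rewrite ab' /= => _ /esym /eqP; rewrite addr0 (negPf (nz _)).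
Qed.

Lemma root_eps2 i j : is_root (eps i + eps j).
Proof.
have [->|ij] := eqVneq i j; first by right; apply: long_eps.
left; move: ij; rewrite -val_eqE neq_ltn => /orP [ij|ij].
  by exists i, j, false, false; rewrite expr0 !scale1r.
by exists j, i, false, false; rewrite expr0 !scale1r addrC.
Qed.

Lemma Psi_eps2 i j : (shifted i + shifted j = n.+2)%N ->
  in_Psi lam (eps i + eps j).
Proof.
move=> E; split; first exact: root_eps2.
rewrite dot_eps2 !lam_rhoE; move: E => /(congr1 (fun x : nat => x%:R : rat)).
rewrite natrD -addn2 natrD => E.
by move: (shifted i)%:R (shifted j)%:R E => x y E; lra.
Qed.

(** An index whose mirror image is also attained belongs to the support of a
    root of [Psi] with nonnegative coefficients, hence not to that of a root of
    [Gamma].  The two indices left are those mirrored to the two gaps. *)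
Lemma Gamma_support a i j : a = eps i + eps j -> in_Gamma lam a ->
  shifted i = (n.+2 - t)%N \/ shifted i = (n.+1 - d)%N.
Proof.
move=> -> [_ _ orth _].
have [-> |nt] := eqVneq (shifted i) (n.+2 - t)%N; first by left.
have [-> |nd] := eqVneq (shifted i) (n.+1 - d)%N; first by right.
have /and3P [le_i _ _] := shifted_range i.
have [||| j' E] := @shifted_surj (n.+2 - shifted i); try by move: le_i nt nd;
  lia.
have /orth : in_Psi lam (eps i + eps j') by apply: Psi_eps2; lia.
rewrite dot_eps2 !eps2E eqxx => /eqP; rewrite gt_eqF //.
by rewrite -!natrD ltr0n.
Qed.

(** Integrality on a long root forces [n] to be even; if the centre of the
    interval is then attained, [Psi] contains a long root as well, which
    excludes long roots from [Gamma].  The centre is a gap only for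
    [n = 2 d]. *)
Lemma Gamma_not_long i : in_Gamma lam (eps i + eps i) -> n = d.*2.
Proof.
move=> [_ [m [m_gt0 mE]] _ short].
have := mE; rewrite dot_coroot_eps2 eqxx lam_rhoE => E.
have {}E : ((shifted i).*2 = m.*2 + n.+2)%N.
  apply/eqP; rewrite -(eqr_nat rat) -!muln2 -addn2 !natrD !natrM; apply/eqP.
  by move: (shifted i)%:R E => x E; lra.
apply/eqP; apply: contraT => nd.
have [||| c cE] := @shifted_surj (shifted i - m); try by move: E nd; lia.
case: (@long_not_short i); apply: short; exists (eps c + eps c); split;
  last exact: long_eps.
by apply: Psi_eps2; lia.
Qed.

(** In the second alternative the gap [d + 1] is its own mirror image, so no
    index [q] is available and the root is long. *)
Lemma GammaP a : in_Gamma lam a -> exists p q,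
  [/\ a = eps p + eps q, shifted p = (n.+2 - t)%N
    & shifted q = (n.+1 - d)%N \/ q = p /\ n = d.*2].
Proof.
move=> Ga; have [[i [j [_ aE]]] _ _ _] := Ga.
have := Gamma_support aE Ga; have := Gamma_support (etrans aE (addrC _ _)) Ga.
have long : shifted i = shifted j -> i = j /\ n = d.*2.
  move=> /shifted_inj ij; split=> //; apply: (@Gamma_not_long j).
  by rewrite -{1}ij -aE.
move=> [jp|jq] [ip|iq].
- have [ij nd] := long (etrans ip (esym jp)).
  by exists i, j; split=> //; right; rewrite ij.
- by exists j, i; split=> //; [rewrite addrC | left].
- by exists i, j; split=> //; left.
- have [ij nd] := long (etrans iq (esym jq)).
  by exfalso; have := shifted_range i; rewrite iq; move: nd; lia.
Qed.

Lemma Gamma_unique a b : in_Gamma lam a -> in_Gamma lam b -> a = b.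
Proof.
move=> /GammaP [p [q [-> pE qE]]] /GammaP [p' [q' [-> pE' qE']]].
have <- : p = p' by apply: shifted_inj; rewrite pE.
congr (_ + eps _).
case: qE qE' => [qE|[-> nd]] [qE'|[-> nd']].
- by apply: shifted_inj; rewrite qE.
- by exfalso; have := shifted_range q; rewrite qE; move: nd'; lia.
- by exfalso; have := shifted_range q'; rewrite qE'; move: nd; lia.
- by apply: shifted_inj; rewrite pE pE'.
Qed.

Lemma min_GammaE a : in_Gamma lam a -> min_Gamma lam = a.
Proof.
move=> Ga; apply: xget_unique => [|b [Gb _]]; last exact: Gamma_unique.
split=> // b Gb; exists [::]; rewrite big_nil (Gamma_unique Gb Ga) subrr;
  split=> //.
Qed.

(** The coordinates, shifted in the same way, of the weight of the determinant
    plus [rho]: the decreasing sequence with the mirror images of the two gaps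
    left out. *)
Definition target i : nat := (n.+2 - i - (d <= i) - (t <= i))%N.

Lemma target_surj x : (x <= n.+2)%N -> x != (n.+2 - t)%N -> x != (n.+1 - d)%N ->
  exists i, target i = x.
Proof.
move=> xn xt xd; rewrite /target.
have [dx|xd'] := ltnP (n.+2 - t) x.
  have ik : (n.+2 - x < k)%N by lia.
  by exists (Ordinal ik) => /=; lia.
have [tx|xt'] := ltnP (n.+1 - d) x.
  have ik : (n.+1 - x < k)%N by lia.
  by exists (Ordinal ik) => /=; lia.
have ik : (n - x < k)%N by lia.
by exists (Ordinal ik) => /=; lia.
Qed.

Lemma target_decr i j : (i < j)%N -> (target j < target i)%N.
Proof. by have := ltn_ord i; have := ltn_ord j; rewrite /target; lia. Qed.

(** The reflection in [eps p + eps q] replaces the values at [p] and [q] by the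
    mirror images of each other's, thereby moving the two gaps to their mirror
    images; the formula also covers [p = q]. *)
Definition reflected p q i : nat :=
  if i == p then (n.+2 - shifted q)%N
  else if i == q then (n.+2 - shifted p)%N else shifted i.

Lemma reflect_rootE p q i :
  (reflect_root (eps p + eps q) (lam + rho k)) 0 i =
  (reflected p q i)%:R - 1 - n%:R / 2%:R.
Proof.
have le j : (shifted j <= n.+2)%N by have /and3P [] := shifted_range j.
rewrite /reflect_root dot_coroot_eps2 mxE [X in _ + X]mxE [X in _ - X]mxE eps2E
  !lam_rhoE.
rewrite /reflected; have [->|ip] := eqVneq i p.
  rewrite /= (natrB _ (le q)) -[n.+2]addn2 natrD; case: (eqVneq p q) => [->|pq]
    /=.
    by move: (shifted q)%:R => x; lra.
  by move: (shifted q)%:R (shifted p)%:R => x y; lra.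
have [iq|iq] := eqVneq i q; last by rewrite addr0 mulr0 subr0.
rewrite iq in ip *.
rewrite /= (natrB _ (le p)) -[n.+2]addn2 natrD; case: (eqVneq p q) => [pq|pq]
  /=.
  by rewrite pq eqxx in ip.
by move: (shifted q)%:R (shifted p)%:R => x y; lra.
Qed.

Lemma reflected_inj p q : shifted p = (n.+2 - t)%N ->
  shifted q = (n.+1 - d)%N \/ q = p /\ n = d.*2 -> injective (reflected p q).
Proof.
move=> pE qE i j; rewrite /reflected.
have {}qE : shifted q = (n.+1 - d)%N \/ shifted q = (n.+2 - t)%N /\ n = d.*2.
  by case: qE => [|[-> nd]]; [left | right].
have := shifted_range i; have := shifted_range j; have := shifted_range q.
have ne l : l != p -> shifted l != shifted p by rewrite (inj_eq shifted_inj).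
have ne' l : l != q -> shifted l != shifted q by rewrite (inj_eq shifted_inj).
have eq l l' : l = l' -> shifted l = shifted l' by move->.
rewrite pE in ne *.
case: (eqVneq i p) => [ip|/ne ip]; case: (eqVneq j p) => [jp|/ne jp];
  first by rewrite ip jp.
- by case: (eqVneq j q) => [/eq jq|/ne' jq]; clear - qE td tdn jp jq; case: qE;
  lia.
- by case: (eqVneq i q) => [/eq iq|/ne' iq]; clear - qE td tdn ip iq; case: qE;
  lia.
case: (eqVneq i q) => [iq|/ne' iq]; case: (eqVneq j q) => [jq|/ne' jq];
  first by rewrite iq jq.
- by clear - td tdn jp jq; lia.
- by clear - td tdn ip iq; lia.
- by move=> _ _ _ /shifted_inj.
Qed.

Lemma reflected_target p q i : shifted p = (n.+2 - t)%N ->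
  shifted q = (n.+1 - d)%N \/ q = p /\ n = d.*2 ->
  exists j, target j = reflected p q i.
Proof.
move=> pE qE.
have {}qE : shifted q = (n.+1 - d)%N \/ shifted q = (n.+2 - t)%N /\ n = d.*2.
  by case: qE => [|[-> nd]]; [left | right].
have Ri := shifted_range i; have Rq := shifted_range q.
have ne l : l != p -> shifted l != shifted p by rewrite (inj_eq shifted_inj).
have ne' l : l != q -> shifted l != shifted q by rewrite (inj_eq shifted_inj).
by apply: target_surj; rewrite /reflected;
  case: (eqVneq i p) => [_|/ne ip]; try (case: (eqVneq i q) => [_|/ne' iq]);
    lia.
Qed.

Lemma lambda'_two_columns i : (exists a, in_Gamma lam a) ->
  lambda' n k two_columns 0 i = - ((d <= i) + (t <= i))%N%:R - n%:R / 2%:R.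
Proof.
move=> [a Ga]; rewrite /lambda' (min_GammaE Ga).
have [p [q [-> pE qE]]] := GammaP Ga.
pose U (j : 'I_k) : rat := (target j)%:R - 1 - n%:R / 2%:R.
set v := reflect_root _ _.
have vE j : v 0 j = (reflected p q j)%:R - 1 - n%:R / 2%:R.
  exact: reflect_rootE.
have shift_inj (x y : nat) :
    x%:R - 1 - n%:R / 2%:R = y%:R - 1 - n%:R / 2%:R :> rat
  -> x = y.
  by move=> E; apply/eqP; rewrite -(eqr_nat rat); apply/eqP; lra.
have -> : decr_rearr v = \row_j U j.
  apply/rowP => j; rewrite !mxE.
  suff -> : sort (fun x y : rat => y <= x) [seq v 0 l | l <- enum 'I_k] =
      [seq U l | l <- enum 'I_k].
    by rewrite (nth_map ord0) ?size_enum_ord // nth_ord_enum.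
  apply: (@sorted_eq _ (fun x y : rat => y <= x)).
  - by move=> x y z; apply: ge_trans.
  - by move=> x y /andP [yx xy]; apply: le_anti; rewrite xy yx.
  - by apply: sort_sorted => x y; apply: le_total.
  - rewrite sorted_map; apply: (@sub_sorted _ (fun x y : 'I_k => x < y)%N).
      by move=> x y /target_decr; rewrite /U /= !lerD2r ler_nat => /ltnW.
    by have := iota_ltn_sorted 0 k; rewrite -val_enum_ord sorted_map.
  - rewrite perm_sort.
    have uv : uniq [seq v 0 l | l <- enum 'I_k].
      rewrite map_inj_uniq ?enum_uniq // => x y; rewrite !vE => /shift_inj.
      exact: reflected_inj.
    have sub :
        {subset [seq v 0 l | l <- enum 'I_k] <= [seq U l | l <- enum 'I_k]}.
      move=> _ /mapP [l _ ->]; have [j' E] := reflected_target l pE qE.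
      by apply/mapP; exists j'; rewrite ?mem_enum // vE -E.
    have [_ mem] := uniq_min_size uv sub
      (eq_leq (etrans (size_map _ _) (esym (size_map _ _)))).
    apply: uniq_perm => //.
    rewrite map_inj_uniq ?enum_uniq // => x y /shift_inj xy.
    apply/val_inj; case: (ltngtP x y) => // /target_decr; rewrite xy ltnn //.
rewrite !mxE /U; have := ltn_ord i => ik.
have : (target i + ((d <= i) + (t <= i)) = (n.+1 - i).+1)%N by rewrite /target;
  lia.
move=> /(congr1 (fun x : nat => x%:R : rat)); rewrite natrD -[X in _ = X]natr1.
by move: (target i)%:R => x E; lra.
Qed.

End RootCombinatorics.

(** * The matrix and its image under multiplication *)

Section BigMatrix.
Variables (C : fieldType) (k n : nat).

Lemma mul_mx_antidiag (S : pzRingType) m p (A : 'M[S]_(m, p)) i l :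
  (A *m antidiag S p) i l = A i (rev_ord l).
Proof.
rewrite mxE (bigD1 (rev_ord l)) //= big1 => [|q /negPf ql]; rewrite mxE.
  by rewrite rev_ordK eqxx mulr1 addr0.
by rewrite -(inj_eq rev_ord_inj) rev_ordK eq_sym ql mulr0.
Qed.

Lemma mul_antidiag_mx (S : pzRingType) m p (A : 'M[S]_(m, p)) l i :
  (antidiag S m *m A) l i = A (rev_ord l) i.
Proof.
rewrite mxE (bigD1 (rev_ord l)) //= big1 => [|q /negPf ql]; rewrite mxE.
  by rewrite eqxx mul1r addr0.
by rewrite ql mul0r.
Qed.

Lemma big_mxE : big_mx C k n =
  block_mx (\matrix_(i, j) rform C n i j)
    (\matrix_(i, l) gen_mx C k n i (rev_ord l))
    (\matrix_(l, i) gen_mx C k n i (rev_ord l)) (antidiag (polyM C k n) n).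
Proof.
rewrite /big_mx mul_col_mx mul1mx mul_col_mx !mul_mx_row !mulmx1 -block_mxEv.
congr block_mx; apply/matrixP => i j.
- rewrite [RHS]mxE [LHS]mxE /rform (reindex_inj rev_ord_inj) /=;
  apply: eq_bigr => l _.
  by rewrite mul_mx_antidiag rev_ordK [_^T _ _]mxE.
- by rewrite mul_mx_antidiag [RHS]mxE.
- by rewrite mul_antidiag_mx [RHS]mxE [LHS]mxE.
Qed.

Lemma tens1l (p : polyM C k n) : tens 1 p = tensr p.
Proof. by rewrite /tens /tensl mpolyC1 mul1r. Qed.

Lemma tens1r (p : polyM C k n) : tens p 1 = tensl p.
Proof. by rewrite /tens /tensr rmorph1 mulr1. Qed.

Lemma map_big_tens_mx : map_mx (@mult_map C k n) (big_tens_mx C k n) = big_mx C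
  k n.
Proof.
have ml p q (A : 'M_(p, q)) : map_mx (@mult_map C k n) (map_mx (@tensl C k n) A)
  = A.
  apply/matrixP => i j; rewrite [LHS]mxE [X in mult_map X]mxE.
  by rewrite -tens1r mult_map_tens mulr1.
have mr p q (A : 'M_(p, q)) : map_mx (@mult_map C k n) (map_mx (@tensr C k n) A)
  = A.
  apply/matrixP => i j; rewrite [LHS]mxE [X in mult_map X]mxE.
  by rewrite -tens1l mult_map_tens mul1r.
by rewrite /big_tens_mx map_block_mx ml !mr submxK.
Qed.

(** Padding both factors with zeros makes them square and singular. *)
Lemma det_mul_narrow (S : comPzRingType) m (A : 'M[S]_(m.+1, m))
  (B : 'M[S]_(m, m.+1)) :
  \det (A *m B) = 0.
Proof.
have -> : A *m B = row_mx (0 : 'cV_m.+1) A *m col_mx (0 : 'rV_m.+1) B.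
  by rewrite mul_row_col mul0mx add0r.
rewrite (@det_mulmx _ (1 + m)) (expand_det_col _ (lshift m ord0)).
by rewrite big1 ?mul0r // => i _; rewrite row_mxEl mxE mul0r.
Qed.

Lemma mxat_map (S S' : nmodType) p q (f : S -> S') (A : 'M_(p, q)) i j :
  f 0 = 0 ->
  mxat (map_mx f A) i j = f (mxat A i j).
Proof.
by rewrite /mxat; case: insub => [i'|//]; case: insub => [j'|//]; rewrite mxE.
Qed.

End BigMatrix.

Section Kernel.
Variables (C : fieldType) (n : nat).
Notation k := n.+1.

Lemma row_of (e : nat) (i : 'I_k) (en : (e <= n)%N) : (e + i < k + n)%N.
Proof. by have := ltn_ord i; lia. Qed.

Lemma sub_tens_mxE e f (en : (e <= n)%N) (fn : (f <= n)%N) i j :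
  sub_tens_mx C k n e.+1 f.+1 i j =
  big_tens_mx C k n (Ordinal (row_of i en)) (Ordinal (row_of j fn)).
Proof. by rewrite mxE; apply: (mxat_ord _ (Ordinal (row_of i en)) (Ordinal
  (row_of j fn))). Qed.

(** The multiplication map sends the matrix to a submatrix of order [n + 1] of
    a product that factors through rank [n]. *)
Lemma mult_map_det_sub_tens e f : (e <= n)%N -> (f <= n)%N ->
  mult_map (\det (sub_tens_mx C k n e.+1 f.+1)) = 0.
Proof.
move=> en fn; rewrite /mult_map -det_map_mx.
pose A := col_mx (gen_mx C k n) 1%:M *m antidiag (polyM C k n) n.
pose B := row_mx (gen_mx C k n)^T 1%:M.
rewrite -[RHS](@det_mul_narrow _ _ (\matrix_(i, l) A (Ordinal (row_of i en)) l)
  (\matrix_(l, j) B l (Ordinal (row_of j fn)))).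
congr (\det _); apply/matrixP => i j.
rewrite mxE sub_tens_mxE.
have := map_big_tens_mx C k n.
move=> /matrixP /(_ (Ordinal (row_of i en)) (Ordinal (row_of j fn))).
rewrite mxE => E; apply: (etrans E); rewrite [LHS]mxE [RHS]mxE;
  apply: eq_bigr => l _.
by rewrite [X in _ = X * _]mxE [X in _ = _ * X]mxE.
Qed.

Variables t d : nat.

Definition tens_bordered_mx : 'M[polyMM C k n]_k :=
  bordered_mx (fun i j => tensl (rform C n i j))
    (fun i l => tensr (xrev C n i l))
    k (k - d) (k - t) (fun i => inord (d + i)) (fun j => inord (t + j)).

Hypotheses (td : (t <= d)%N) (tdn : (t + d <= n)%N).

Lemma explicit_mx_bordered : explicit_mx C n d t = tens_bordered_mx.
Proof.
apply/matrixP => i j; rewrite !mxE.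
have tensr0 : tensr (0 : polyM C k n) = 0 by rewrite /tensr raddf0.
have row_ord e (i' : nat) : (i' < k - e)%N -> (e + i')%N =
  (inord (e + i') : 'I_k) :> nat.
  by move=> ie; rewrite inordK //; lia.
case: ltnP => ip; case: ltnP => jq //.
- by rewrite (row_ord d i) // (row_ord t j) // mxat_ord mxE !inord_val.
- by rewrite (row_ord d i ip) (mxat_map _ _ _ tensr0) /xrev inord_val.
- by rewrite (row_ord t j jq) (mxat_map _ _ _ tensr0) /xrev inord_val.
Qed.

(** The lower right block vanishes because a one of the antidiagonal would
    need [t + d > n]. *)
Lemma sub_tens_mx_bordered : sub_tens_mx C k n d.+1 t.+1 = tens_bordered_mx.
Proof.
have dn : (d <= n)%N by lia. have tn : (t <= n)%N by lia.
apply/matrixP => i j; rewrite (sub_tens_mxE dn tn) [RHS]mxE.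
have ord_l e (i' : 'I_k) (en : (e <= n)%N) : (i' < k - e)%N ->
    Ordinal (row_of i' en) = lshift n (inord (e + i') : 'I_k).
  by move=> ie; apply/val_inj; rewrite /= inordK //; lia.
have ord_r e (i' : 'I_k) (en : (e <= n)%N) : (k - e <= i')%N ->
    exists2 l : 'I_n, Ordinal (row_of i' en) = rshift k l & l = (i' - (k - e))%N
      :> nat.
  move=> ie; have ln : (i' - (k - e) < n)%N by have := ltn_ord i'; lia.
  by exists (Ordinal ln) => //; apply/val_inj => /=; lia.
rewrite /big_tens_mx big_mxE block_mxKul block_mxKur block_mxKdl block_mxKdr.
case: ltnP => ip; case: ltnP => jq.
- by rewrite !ord_l // block_mxEul mxE [X in tensl X]mxE.
- have [l -> lE] := ord_r t j tn jq; rewrite ord_l // block_mxEur mxE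
  [X in tensr X]mxE.
  by rewrite -lE xrev_ord.
- have [l -> lE] := ord_r d i dn ip; rewrite ord_l // block_mxEdl mxE
  [X in tensr X]mxE.
  by rewrite -lE xrev_ord.
have [l -> lE] := ord_r d i dn ip; have [l' -> lE'] := ord_r t j tn jq.
rewrite block_mxEdr mxE [X in tensr X]mxE (_ : (l' == _) = false) ?mulr0n
  ?/tensr ?raddf0 //.
apply/eqP => /(congr1 val) /=; have := ltn_ord i; have := ltn_ord j.
rewrite lE lE'; lia.
Qed.

End Kernel.

(** * The action on the determinant *)

Section TensorDerivation.
Variables (C : fieldType) (k n : nat).
Implicit Types (i j a b : 'I_k) (y z : polyMM C k n).

Lemma polar1 i j : polar i j (1 : polyM C k n) = 0.
Proof. exact: der1 (polarM i j). Qed.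

Lemma polar_rform i j a b :
  polar i j (rform C n a b) =
  (if a == j then rform C n i b else 0) + (if b == j then rform C n a i else 0).
Proof.
rewrite /rform (der_sum (polarD i j)).
under eq_bigr => l _ do rewrite polarM !polar_gen.
rewrite big_split /=; congr (_ + _); case: eqP => _ //;
  by rewrite big1 // => l _; rewrite ?mul0r ?mulr0.
Qed.

(** Without its scalar term [h_ij] is a derivation of the tensor product. *)
Definition tens_der i j z : polyMM C k n :=
  tens_act i j z - ((n%:R / 2%:R *+ (i == j))%:MP : polyM C k n) *: z.

Lemma tens_derE i j z : tens_der i j z =
  map_mpoly (@polar C k n i j) z
  + \sum_(l < n) 'X_(mxvec_index i l) * z^`M(mxvec_index j l).
Proof. by rewrite /tens_der /tens_act addrA addrK. Qed.

Lemma mcoeff_map_polar i j z m :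
  (map_mpoly (@polar C k n i j) z)@_m = polar i j z@_m.
Proof.
have polarB : zmod_morphism (@polar C k n i j).
  by move=> p q; rewrite polarD (derN (polarD i j)).
pose A := GRing.isZmodMorphism.Build _ _ _ polarB.
pose f : {additive polyM C k n -> polyM C k n} := HB.pack (@polar C k n i j) A.
exact: (mcoeff_map_mpoly f).
Qed.

Lemma tens_derD i j : {morph tens_der i j : y z / y + z}.
Proof.
move=> y z; rewrite !tens_derE addrACA; congr (_ + _).
  apply/mpolyP => m; rewrite [LHS]mcoeff_map_polar (mcoeffD m y z) polarD
    [RHS]mcoeffD.
  by rewrite -(mcoeff_map_polar i j y) -(mcoeff_map_polar i j z).
by rewrite -big_split; apply: eq_bigr => l _; rewrite mderivD mulrDr.
Qed.

Lemma tens_derM i j y z :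
  tens_der i j (y * z) = tens_der i j y * z + y * tens_der i j z.
Proof.
rewrite !tens_derE mulrDl mulrDr addrACA; congr (_ + _).
  apply/mpolyP => m; rewrite [LHS]mcoeff_map_polar [RHS]mcoeffD !mcoeffM
    (der_sum (polarD i j)).
  rewrite -big_split; apply: eq_bigr => mm _ /=.
  by rewrite polarM -(mcoeff_map_polar i j y) -(mcoeff_map_polar i j z).
rewrite mulr_suml mulr_sumr -big_split; apply: eq_bigr => l _ /=.
by rewrite mderivM mulrDr -mulrA [RHS]addrC [in RHS]mulrCA addrC.
Qed.

Lemma tens_der_tensl i j (p : polyM C k n) :
  tens_der i j (tensl p) = tensl (polar i j p).
Proof.
rewrite /tens_der -tens1r tens_act_tens /hop polar1 add0r tens1r.
by rewrite -addrA /tens /tensr map_mpolyZ rmorph1 -mul_mpolyC mulr1 mulrC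
  mul_mpolyC mulr1 subrr addr0.
Qed.

Lemma tens_der_tensr i j (p : polyM C k n) :
  tens_der i j (tensr p) = tensr (polar i j p).
Proof.
rewrite /tens_der -tens1l tens_act_tens polar1 {1}/tens /tensl raddf0 mul0r
  add0r.
rewrite !tens1l /hop /tensr raddfD /= map_mpolyZ addrK //.
Qed.

End TensorDerivation.

Section HighestWeight.
Variables (C : fieldType) (n t d : nat).
Hypotheses (td : (t <= d)%N) (tdn : (t + d <= n)%N).
Notation k := n.+1.
Notation M := (tens_bordered_mx C n t d).

(** The row labels run from [d] to [n] and the column labels from [t] to [n].
    As [j <= i], wherever [j] is one of them so is the label [i] that replaces
    it, and the derivation is given by a matrix unit, or zero, on either
    side. *)
Lemma tens_der_bordered (i j : 'I_k) : (j <= i)%N ->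
  map_mx (tens_der i j) M =
  (\matrix_(r, s) ((d + r == j)%N && (d + s == i)%N)%:R) *m M
  + M *m (\matrix_(r, s) ((t + s == j)%N && (t + r == i)%N)%:R).
Proof.
move=> ji; apply/matrixP => r s; rewrite [LHS]mxE [RHS]mxE.
have inordE e (r' : 'I_k) : (r' < k - e)%N -> ((inord (e + r') : 'I_k) == j) =
  (e + r' == j)%N.
  by move=> re; rewrite -val_eqE /= inordK //; lia.
have rows : ((\matrix_(r, s) ((d + r == j)%N && (d + s == i)%N)%:R) *m M) r s =
    if (d + r == j)%N then
      if (s < k - t)%N then tensl (rform C n i (inord (t + s))) else tensr
        (xrev C n i (s - (k - t)))
    else 0.
  rewrite [LHS]mxE; case: eqP => drj; last first.
    by rewrite big1 // => r' _; rewrite mxE; case: eqP => //; rewrite mul0r.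
  have ik : (i - d < k)%N by have := ltn_ord i; lia.
  rewrite (bigD1 (Ordinal ik)) //= big1 => [|r' ne]; rewrite mxE drj eqxx /=.
    have di : (d + (i - d))%N = i by lia.
    rewrite di eqxx mul1r addr0 mxE /= di inord_val (_ : (i - d < k - d)%N) //.
    by have := ltn_ord i; lia.
  case: eqP => [di|_]; last by rewrite mul0r.
  by case/eqP: ne; apply/val_inj => /=; lia.
have cols : (M *m (\matrix_(r, s) ((t + s == j)%N && (t + r == i)%N)%:R)) r s =
    if (t + s == j)%N then
      if (r < k - d)%N then tensl (rform C n (inord (d + r)) i) else tensr
        (xrev C n i (r - (k - d)))
    else 0.
  rewrite [LHS]mxE; case: eqP => tsj; last first.
    by rewrite big1 // => r' _; rewrite [X in _ * X]mxE; case: eqP => //;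
      rewrite mulr0.
  have ik : (i - t < k)%N by have := ltn_ord i; lia.
  rewrite (bigD1 (Ordinal ik)) //= big1 => [|r' ne]; rewrite [X in _ * X]mxE tsj
    eqxx /=.
    have ti : (t + (i - t))%N = i by lia.
    rewrite ti eqxx mulr1 addr0 mxE /= ti inord_val (_ : (i - t < k - t)%N) //.
    by have := ltn_ord i; lia.
  case: eqP => [ti|_]; last by rewrite mulr0.
  by case/eqP: ne; apply/val_inj => /=; lia.
rewrite [X in _ = X + _]rows [X in _ = _ + X]cols [M r s]mxE;
  have rk := ltn_ord r; have sk := ltn_ord s; have jk := ltn_ord j.
have tensl0 : tensl (0 : polyM C k n) = 0 by rewrite /tensl raddf0.
have tensr0 : tensr (0 : polyM C k n) = 0 by rewrite /tensr raddf0.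
case: (ltnP r (k - d)) => rd; case: (ltnP s (k - t)) => st.
- rewrite tens_der_tensl polar_rform !inordE // /tensl raddfD /=.
  by congr (_ + _); case: ifP => _ //; rewrite raddf0.
- rewrite tens_der_tensr polar_xrev inordE // (_ : (t + s == j)%N = false)
  ?addr0; last by lia.
  by case: ifP => _; rewrite ?tensr0.
- rewrite tens_der_tensr polar_xrev inordE // (_ : (d + r == j)%N = false)
  ?add0r; last by lia.
  by case: ifP => _; rewrite ?tensr0.
have -> : (d + r == j)%N = false by lia.
have -> : (t + s == j)%N = false by lia.
by rewrite addr0; apply: der0 (@tens_derD _ _ _ i j).
Qed.

Lemma trace_shift e (i j : 'I_k) (P : 'M[polyMM C k n]_k) :
    (forall r, P r r = ((e + r == j)%N && (e + r == i)%N)%:R) ->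
  \tr P = ((i == j) && (e <= i)%N)%:R.
Proof.
move=> Pr; rewrite /mxtrace (eq_bigr _ (fun r _ => Pr r)) {P Pr}.
have [-> /=|ij /=] := eqVneq i j; last first.
  rewrite big1 // => r _; case: eqP => // E; case: eqP => // E'.
  by case/eqP: ij; apply/val_inj => /=; lia.
have [ej|je] := leqP e j; last first.
  by rewrite big1 // => r _; case: eqP => // E; move: je; rewrite -E; lia.
have jk : (j - e < k)%N by have := ltn_ord j; lia.
rewrite (bigD1 (Ordinal jk)) //= subnKC // eqxx big1 ?addr0 // => r ne.
case: eqP => // E; case/eqP: ne; apply/val_inj => /=; lia.
Qed.

(** For [i != j] the two matrices have trace zero; for [i = j] the traces count
    the occurrences of the label [i]. *)
Lemma tens_act_det_bordered (i j : 'I_k) : (j <= i)%N ->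
  tens_act i j (\det M) =
  ((((d <= i) + (t <= i))%N%:R + n%:R / 2%:R) *+ (i == j))%:MP%:MP * \det M.
Proof.
move=> ji; have -> : tens_act i j (\det M) = tens_der i j (\det M) +
    ((n%:R / 2%:R *+ (i == j))%:MP : polyM C k n) *: \det M by rewrite /tens_der
      subrK.
rewrite (der_det_lin (@tens_derD _ _ _ i j) (tens_derM i j) (tens_der_bordered
  ji)).
rewrite (@trace_shift d i j) => [|r]; last by rewrite mxE.
rewrite (@trace_shift t i j) => [|r]; last by rewrite mxE.
rewrite -mul_mpolyC -mulrDl; congr (_ * _).
have [_|_] := eqVneq i j; last by rewrite /= !mulr0n !raddf0 !addr0.
by rewrite /= !mulr1n !mpolyCD !rmorph_nat natrD.
Qed.

End HighestWeight.

(** * The determinant does not vanish *)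

Section Nonvanishing.
Variables (C : numClosedFieldType) (n t d : nat).
Hypotheses (td : (t <= d)%N) (tdn : (t + d <= n)%N) (d_gt0 : (0 < d)%N).
Notation k := n.+1.

Definition eval2 (U V : 'M[C]_(k, n)) (z : polyMM C k n) : C :=
  (z.@[fun v => (mxvec V 0 v)%:MP]).@[fun v => mxvec U 0 v].

Lemma eval2_rform U V i j :
  eval2 U V (tensl (rform C n i j)) = \sum_l U i l * U j (rev_ord l).
Proof.
rewrite /eval2 /tensl mevalC /rform raddf_sum /=; apply: eq_bigr => l _.
by rewrite mevalM !mxE !mevalXU !mxvecE.
Qed.

Lemma eval2_gen U V i l : eval2 U V (tensr (gen_mx C k n i l)) = V i l.
Proof. by rewrite /eval2 /tensr mxE map_mpolyX mevalXU mevalC mxvecE. Qed.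

(** A point whose rows, apart from the zero row of index 0, are pairwise
    orthogonal and not isotropic: the row of index [l + 1] is the basis vector
    of index [l] plus ['i] times its mirror image.  Since [n + 1] vectors cannot
    be orthogonal and not isotropic in dimension [n], one row has to be given
    up; the row labels of the determinant start at [d > 0]. *)
Definition gram_point : 'M[C]_(k, n) :=
  \matrix_(i, l) ((i == l.+1 :> nat)%:R + 'i *+ (i == (rev_ord l).+1 :> nat)).

Lemma gram_pointE (i j : 'I_k) : (0 < i)%N ->
  \sum_l gram_point i l * gram_point j (rev_ord l) = 'i *+ 2 *+ (i == j).
Proof.
move=> i_gt0; have il : (i.-1 < n)%N by have := ltn_ord i; lia.
pose l0 := Ordinal il.
have row (l : 'I_n) : gram_point i l = (l == l0)%:R + 'i *+ (rev_ord l == l0).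
  by rewrite mxE -!(inj_eq val_inj) /=; congr (_%:R + _ *+ _);
    apply/eqP/eqP => /=; lia.
under eq_bigr => l _ do rewrite row mulrDl.
rewrite big_split /= (bigD1 l0) //= eqxx mul1r big1 => [|l /negPf ->];
  last by rewrite mul0r.
rewrite (reindex_inj rev_ord_inj) /=.
under eq_bigr => l _ do rewrite rev_ordK.
rewrite (bigD1 l0) //= eqxx big1 => [|l /negPf ->];
  last by rewrite mulr0n mul0r.
rewrite mulr1n !addr0 [gram_point j l0]mxE [gram_point j (rev_ord l0)]mxE
  rev_ordK.
have -> : (j == l0.+1 :> nat) = (i == j) by rewrite -val_eqE /= prednK //
  eq_sym.
case: (i == j); case: (j == _ :> nat); rewrite ?mulr0n ?mulr1n ?mulrDr ?mulr1
  ?mulr0 ?addr0 ?add0r.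
- by rewrite -expr2 sqrCi addrCA [_ - 1]addrC addKr -mulr2n.
- by rewrite mulr2n.
- by rewrite -expr2 sqrCi subrr.
- by [].
Qed.

(** The column [l] from the right meets only the row [pivot l].  For [l < t]
    this row is a row and a column label of the determinant, for
    [t <= l < d] a column label only; the labels from [d] to [n - t] are left to
    the Gram matrix. *)
Definition pivot (l : nat) : nat := if (l < t)%N then (n - l)%N else l.

Definition pivot_point : 'M[C]_(k, n) :=
  \matrix_(j, l) (j == pivot (rev_ord l) :> nat)%:R.

Lemma eval2_xrev (U : 'M[C]_(k, n)) (i : 'I_k) l : (l < n)%N ->
  eval2 U pivot_point (tensr (xrev C n i l)) = (i == pivot l :> nat)%:R.
Proof.
by move=> ln; rewrite (xrev_ord C i (Ordinal ln)) eval2_gen mxE rev_ordK.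
Qed.

(** At the chosen point the matrix is so sparse that the coordinates of a left
    kernel vector can be shown to vanish one at a time: the last columns
    remove the rows with labels beyond [n - t], the columns with labels from
    [d] to [n - t] the other rows of the upper blocks, and the remaining columns
    the lower rows. *)
Lemma det_bordered_neq0 : \det (tens_bordered_mx C n t d) != 0.
Proof.
pose ev z := eval2 gram_point pivot_point z.
suff: ev (\det (tens_bordered_mx C n t d)) != 0.
  by apply: contraNneq => ->; rewrite /ev /eval2 !raddf0.
pose N : 'M[C]_k := \matrix_(r, s)
  if (r < k - d)%N then
    if (s < k - t)%N then 'i *+ 2 *+ (d + r == t + s)%N
    else (d + r == pivot (s - (k - t)))%N%:R
  else if (s < k - t)%N then (t + s == pivot (r - (k - d)))%N%:R else 0.
have -> : ev (\det (tens_bordered_mx C n t d)) = \det N.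
  rewrite /ev /eval2 -!det_map_mx; congr (\det _); apply/matrixP => r s.
  have rk := ltn_ord r; have sk := ltn_ord s.
  rewrite [LHS]mxE /= [X in X.@[_]]mxE [tens_bordered_mx _ _ _ _ _ _]mxE
    [RHS]mxE -/(eval2 _ _ _).
  have inordE e (r' : 'I_k) : (r' < k - e)%N -> (inord (e + r') : 'I_k) =
    (e + r')%N :> nat.
    by move=> re; rewrite inordK //; lia.
  case: (ltnP r (k - d)) => rd; case: (ltnP s (k - t)) => st.
  - rewrite eval2_rform gram_pointE ?inordE //; last by lia.
    by rewrite -val_eqE /= !inordE.
  - by rewrite eval2_xrev ?inordE //; lia.
  - by rewrite eval2_xrev ?inordE //; lia.
  - by rewrite /eval2 !raddf0.
apply/negP => /det0P [y + yN].
have yN_eq0 (s : 'I_k) : \sum_r y 0 r * N r s = 0.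
  by have := congr1 (fun v : 'rV_k => v 0 s) yN; rewrite !mxE.
have pick (r s : 'I_k) : N r s != 0 ->
  (forall r', r' != r -> y 0 r' * N r' s = 0) -> y 0 r = 0.
  move=> Nrs others; have := yN_eq0 s; rewrite (bigD1 r) //= big1 // addr0.
  by move/eqP; rewrite mulf_eq0 (negPf Nrs) orbF => /eqP.
have i2 : ('i : C) *+ 2 != 0 by rewrite mulrn_eq0 /= neq0Ci.
have topA (r : 'I_k) : (r < k - d)%N -> (n - t < d + r)%N -> y 0 r = 0.
  move=> rd lt; have sk : (k - t + (n - (d + r)) < k)%N by lia.
  have st : (k - t + (n - (d + r)) < k - t)%N = false by lia.
  have piv : pivot (n - (d + r)) = (d + r)%N.
    by rewrite /pivot (_ : (n - (d + r) < t)%N); lia.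
  apply: (pick r (Ordinal sk)) => [|r' ne].
    by rewrite mxE rd /= st addKn piv eqxx pnatr_eq0.
  rewrite mxE /= st addKn piv; case: ltnP => r'd; last by rewrite mulr0.
  by rewrite eqn_add2l -val_eqE in ne *; rewrite (negPf ne) mulr0.
have topS (r : 'I_k) : (r < k - d)%N -> y 0 r = 0.
  move=> rd; have [lt|le] := ltnP (n - t) (d + r); first exact: topA.
  have sk : (d + r - t < k)%N by lia.
  have dr : (t + (d + r - t) = d + r)%N by lia.
  have st : (d + r - t < k - t)%N by lia.
  apply: (pick r (Ordinal sk)) => [|r' ne].
    by rewrite mxE rd /= st dr eqxx.
  rewrite mxE /= st dr; have r'k := ltn_ord r'; case: ltnP => r'd.
    rewrite (_ : (d + r' == _)%N = false) ?mulr0n ?mulr0 //; move: ne;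
      rewrite -val_eqE /=; lia.
  by rewrite (_ : (_ == pivot _) = false) ?mulr0 // /pivot; case: ltnP => ?;
    lia.
move/eqP; apply; apply/rowP => r; rewrite mxE; have rk := ltn_ord r.
have [rd|dr] := ltnP r (k - d); first exact: topS.
have [st sE] : (pivot (r - (k - d)) - t < k - t)%N /\
    (t + (pivot (r - (k - d)) - t) = pivot (r - (k - d)))%N.
  by rewrite /pivot; case: (ltnP (r - (k - d)) t) => ?; lia.
have sk : (pivot (r - (k - d)) - t < k)%N by lia.
apply: (pick r (Ordinal sk)) => [|r' ne]; rewrite mxE /= st.
  by rewrite (leq_gtF dr) sE eqxx pnatr_eq0.
case: ltnP => r'd; first by rewrite topS ?mul0r.
rewrite sE (_ : (_ == _) = false) ?mulr0 //; move: ne; have := ltn_ord r'.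
by rewrite -val_eqE /pivot /=; case: (ltnP (r - (k - d)) t) => ?;
  case: (ltnP (r' - (k - d)) t) => ?; lia.
Qed.

End Nonvanishing.

(** * The main result *)

Lemma in_tensor_det_bordered (C : numFieldType) (n t d : nat) :
  (t <= d)%N -> (t + d <= n)%N ->
  in_tensor (@O_invariant C n.+1 n)
    (fun p => in_F (nseq t 2%N ++ nseq (d - t) 1%N) p /\ harmonic p)
    (\det (tens_bordered_mx C n t d)).
Proof.
move=> td tdn; set B := fun p => _.
have BZ c p : B p -> B (c *: p).
  move=> [Fp Hp]; split=> [V subV Vd|i j]; first exact: submodZ (Fp V subV Vd).
  rewrite /laplacian; under eq_bigr => l _ do rewrite /dx !mderivZ.
  by rewrite -scaler_sumr; have := Hp i j; rewrite /laplacian /dx => ->;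
    rewrite scaler0.
have Nd : (n.+1 - d = (n.+1 - (t + d)) + t)%N by lia.
have Nt : (n.+1 - t = (n.+1 - (t + d)) + d)%N by lia.
rewrite /tens_bordered_mx Nd Nt; apply: (bordered_ind (W := in_tensor _ B)).
- exact: in_tensor0.
- exact: in_tensorD.
- move=> x Wx; rewrite (_ : - x = ((-1)%:MP)%:MP * x); first exact:
  in_tensorZ (BZ (-1)) Wx.
  by rewrite !mpolyCN !mpolyC1 mulN1r.
- move=> m x /(in_tensorZ (BZ m.+1%:R^-1)).
  have mE : ((m.+1%:R : C)%:MP)%:MP = m.+1%:R :> polyMM C n.+1 n by rewrite
    !rmorph_nat.
  rewrite -[x *+ _]mulr_natl mulrA -mE -!mpolyCM mulVf ?pnatr_eq0 //.
  by rewrite !mpolyC1 mul1r.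
- move=> i j x; apply: (in_tensor_map (f := *%R (rform C n i j)) (g := id))
  => //.
  + exact: mulrDr.
  + exact: mulr0.
  + by move=> p; apply: O_invariantM; apply: O_invariant_rform.
  + by move=> p q; rewrite /tens /tensl rmorphM /= mulrA.
- move=> a b; have tensE m (c : nat -> 'I_n.+1) :
      \det (\matrix_(i < m, l < m) tensr (xrev C n (c i) l)) =
      tensr (minor C n (fun i : 'I_m => c i)).
    rewrite minor.unlock /tensr -(det_map_mx (map_mpoly (@mpolyC (n.+1 * n)
      C))).
    apply: (congr1 (@determinant _ m)); apply/matrixP => i j.
    by rewrite [LHS]mxE [RHS]mxE [X in _ = _ X]mxE.
  rewrite !tensE -tensr_mul -tens1l.
  exists [:: (1, minor C n (fun i : 'I_t => a i) * minor C n (fun i : 'I_d => b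
    i))].
  rewrite big_seq1; split=> // pq; rewrite inE => /eqP ->; split; first exact:
    O_invariant1.
  by split; [apply: in_F_minors => //; lia | apply: harmonic_minors].
- by lia.
Qed.

Theorem theorem4p1 (R : realType) (n : nat) (sigma : seq nat) (t d : nat)
    (n_ge1 : (1 <= n)%N) (sigma_Omega0 : in_Omega0 n n.+1 sigma)
    (sigma_type : has_type t d sigma) (d_gt0 : (0 < d)%N) :
  let D : polyMM (R[i])%C n.+1 n := \det (sub_tens_mx _ n.+1 n d.+1 t.+1) in
  [/\ D = \det (explicit_mx _ n d t),
      in_tensor (@O_invariant _ _ _) (@harmonic _ _ _) D,
      in_Ker_mult sigma D
    & is_hwv (lambda' n n.+1 sigma) D].
Proof.
move: sigma_type => /andP [/eqP sigmaE td]; subst sigma.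
case: sigma_Omega0 => _ [/and3P [_ _ cols] Gamma_ex].
have tdn : (t + d <= n)%N.
  by move: cols; rewrite /col_len !count_cat !count_nseq /=; lia.
have tn : (t <= n)%N by lia. have dn : (d <= n)%N by lia.
move=> D; have DE : D = \det (tens_bordered_mx _ n t d).
  by rewrite /D sub_tens_mx_bordered.
have D_mult : mult_map D = 0 by exact: mult_map_det_sub_tens dn tn.
clearbody D; subst D.
have D_tensor := in_tensor_det_bordered (R[i])%C td tdn.
split.
- by rewrite explicit_mx_bordered.
- by apply: in_tensorS D_tensor => p [].
- split; first by apply: in_tensorS D_tensor => p [].
  exact: D_mult.
- split; first exact: det_bordered_neq0.
    move=> i; rewrite tens_act_det_bordered // eqxx mulr1n -mul_mpolyC.
    have <- : ((d <= i) + (t <= i))%N%:R + n%:R / 2%:R =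
        - ratr (lambda' n n.+1 (nseq t 2%N ++ nseq (d - t) 1%N) 0 i) :>
          (R[i])%C.
      rewrite (lambda'_two_columns td tdn i Gamma_ex) rmorphB rmorphN /=
        ratr_nat.
      by rewrite fmorph_div /= !ratr_nat opprD opprK opprK.
    by [].
  move=> i j ij; rewrite (tens_act_det_bordered _ td tdn (ltnW ij)).
  by rewrite (_ : (j == i) = false) ?mulr0n ?raddf0 ?mul0r // -val_eqE gtn_eqF.
Qed.
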